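(* Let $X_1,X_2,\dots$ be i.i.d. $\sim P_X$ on a finite alphabet $\mathcal{X}$, let $\hat{\mathcal{X}}_1,\hat{\mathcal{X}}_2$ be finite reconstruction alphabets, and let $d_i:\mathcal{X}\times\hat{\mathcal{X}}_i\to[0,\infty)$, $i=1,2$, be distortion measures. A $(2^{nR_0},2^{nR_1},n)$ code for successive refinement with perfect causal cribbing consists of: - encoder maps $T_0=f_0(X^n)\in\{1,\dots,2^{nR_0}\}$ (to both decoders) and $T_1=f_1(X^n)\in\{1,\dots,2^{nR_1}\}$ (to Decoder 1 only); - a Decoder 1 map $\hat X_1^n=g_1(T_0,T_1)$; - Decoder 2 maps $\hat X_{2,i}=g_{2,i}(T_0,\hat X_1^{i})$, $i=1,\dots,n$. A pair $(R_0,R_1)$ is achievable for $(D_1,D_2)$ if for every $\epsilon>0$ there exist $n$ and such a code with $\mathbb{E}\big[\frac1n\sum_{j} d_i(X_j,\hat X_{i,j})\big]\le D_i+\epsilon$, $i=1,2$. Let $\mathcal{R}(D_1,D_2)$ be the closure of the set of achievable pairs. Then $\mathcal{R}(D_1,D_2)$ is the closure of the set of all $(R_0,R_1)$ such that $$R_0+R_1\ge I(X;\hat X_1,U),\qquad R_0\ge \{I(X;\hat X_1,U)-H(\hat X_1|U)\}^+$$ for some auxiliary random variable $U$ on a finite alphabet $\mathcal{U}$ with $|\mathcal{U}|\le|\mathcal{X}||\hat{\mathcal{X}}_1|+4$, some joint distribution $P_{X,\hat X_1,U}$ with $X$-marginal $P_X$, and some function $f:\mathcal{U}\times\hat{\mathcal{X}}_1\to\hat{\mathcal{X}}_2$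 with $\hat X_2=f(U,\hat X_1)$, such that $\mathbb{E}[d_i(X,\hat X_i)]\le D_i$ for $i=1,2$.
   Context: $\{a\}^+=\max(a,0)$.
   Formalization: The single-letter region is restricted to pairs with R_1 ≥ 0, which the statement leaves implicit; without it pairs with negative R_1 and large R_0 would satisfy the inequalities though no code with such a rate exists. *)

(* Defs.v *)
From HB Require Import structures.
From mathcomp Require Import all_boot all_order all_algebra.
From mathcomp Require Import all_classical all_reals all_analysis.
Set Implicit Arguments. Unset Strict Implicit. Unset Printing Implicit Defensive.
Import Order.TTheory GRing.Theory Num.Theory.
Local Open Scope ring_scope.

Section Info.
Variable R : realType.

Definition log2 (x : R) : R := ln x / ln 2.

Definition is_pmf (T : finType) (p : {ffun T -> R}) : Prop :=
  (forall t, 0 <= p t) /\ \sum_t p t = 1.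

Definition marg1 (A B : finType) (p : {ffun A * B -> R}) : {ffun A -> R} :=
  [ffun a => \sum_b p (a, b)].
Definition marg2 (A B : finType) (p : {ffun A * B -> R}) : {ffun B -> R} :=
  [ffun b => \sum_a p (a, b)].

(* I(A;B) for a joint pmf p on A*B, convention 0 log 0 = 0 *)
Definition mutinfo (A B : finType) (p : {ffun A * B -> R}) : R :=
  \sum_(ab : A * B)
    (if 0 < p ab then p ab * log2 (p ab / (marg1 p ab.1 * marg2 p ab.2)) else 0).

Definition condent (A B : finType) (p : {ffun A * B -> R}) : R :=
  - \sum_(ab : A * B)
    (if 0 < p ab then p ab * log2 (p ab / marg2 p ab.2) else 0).

Definition iid (X : finType) (PX : {ffun X -> R}) n (x : n.-tuple X) : R :=
  \prod_(j < n) PX (tnth x j).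

Definition exp_dist (X Y : finType) (PX : {ffun X -> R}) (d : X -> Y -> R)
  n (rec : n.-tuple X -> 'I_n -> Y) : R :=
  \sum_(x : n.-tuple X) iid PX x * (n%:R^-1 * \sum_(j < n) d (tnth x j) (rec x j)).

(* (R0,R1) is achievable for (D1,D2): for every eps > 0 there is a code of some
   block length n with at most 2^{nR0} common messages, at most 2^{nR1} private
   messages, encoders f0 f1, Decoder 1 g1 and causal cribbing Decoder 2
   (g2 i sees T0 and the prefix Xhat_1^{i+1} only). *)
Definition achievable (X X1 X2 : finType) (PX : {ffun X -> R})
  (d1 : X -> X1 -> R) (d2 : X -> X2 -> R) (D1 D2 : R) (r : R * R) : Prop :=
  forall eps : R, 0 < eps ->
  exists n : nat, (0 < n)%N /\
  exists M0 M1 : nat,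
    M0%:R <= 2 `^ (n%:R * r.1) /\ M1%:R <= 2 `^ (n%:R * r.2) /\
  exists (f0 : n.-tuple X -> 'I_M0) (f1 : n.-tuple X -> 'I_M1)
         (g1 : 'I_M0 -> 'I_M1 -> n.-tuple X1)
         (g2 : 'I_n -> 'I_M0 -> seq X1 -> X2),
    let xh1 := fun x => g1 (f0 x) (f1 x) in
    exp_dist PX d1 (fun x j => tnth (xh1 x) j) <= D1 + eps /\
    exp_dist PX d2 (fun x j => g2 j (f0 x) (take j.+1 (val (xh1 x)))) <= D2 + eps.

Definition sr_region (X X1 X2 : finType) (PX : {ffun X -> R})
  (d1 : X -> X1 -> R) (d2 : X -> X2 -> R) (D1 D2 : R) (r : R * R) : Prop :=
  0 <= r.2 /\
  exists (U : finType) (P : {ffun X * (X1 * U) -> R}) (f : U -> X1 -> X2),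
    (#|U| <= #|X| * #|X1| + 4)%N /\
    is_pmf P /\ marg1 P = PX /\
    \sum_(t : X * (X1 * U)) P t * d1 t.1 t.2.1 <= D1 /\
    \sum_(t : X * (X1 * U)) P t * d2 t.1 (f t.2.2 t.2.1) <= D2 /\
    mutinfo P <= r.1 + r.2 /\
    Num.max (mutinfo P - condent (marg2 P)) 0 <= r.1.

End Info.

(* Main.v *)
Require Import Defs.
From HB Require Import structures.
From mathcomp Require Import all_boot all_order all_algebra.
From mathcomp Require Import all_classical all_reals all_analysis.
From mathcomp Require Import ring lra.
Import Order.TTheory GRing.Theory Num.Theory.
Import numFieldNormedType.Exports.
Local Open Scope ring_scope.
Set Implicit Arguments.
Unset Strict Implicit.

(** Write V for the first reconstruction X1-hat.

    Achievability. Revealing V to the auxiliary variable with some probability l keeps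
    I(X;V,U) and multiplies H(V|U) by 1 - l, so one may assume H(V|U) <= R1 and
    I(X;V,U) - H(V|U) = I(X;U) - H(V|X,U) <= R0. Cover the blocks x by about 2^(N I(X;U))
    codewords u, and colour all blocks v with about 2^(N H(V|X,U)) colours so that every
    typical pair (x,u) is compatible with blocks v of every colour. In block b the encoder
    chooses v of the colour that gives the remainder of the index of the next codeword;
    the quotient of this index is the common message, and the private message is the rank
    of v among the blocks typical with u. Decoder 2 finds the next codeword from the colour
    of the block v that it has observed. No step can fail: an atypical x is encoded as if it
    were a fixed typical one.

    Converse. Take U_i = (i, T0, V^(i-1)) with i uniform. Then
      n I(X;V,U) <= sum_i I(X_i; T0, V^n, X^(i-1)) = I(X^n; T0, V^n) <= H(T0, V^n)
    and n H(V|U) = H(T0, V^n) - H(T0). The alphabet of U is reduced by a conic Caratheodory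
    argument, after which the slack eps is removed by compactness. *)

(** * Random choice of functions *)

(** In block-Markov schemes a decoding error in one block usually spoils all later ones. Here the
    chain of decoders is exact by construction: the codeword indices are recovered for every source
    sequence, and typicality enters only through the distortion. By linearity the excess distortion
    is [dmax] times the probability that one block is bad, so errors do not accumulate over the
    blocks; their number only has to be large enough to amortise the first remainder.

    Typicality means that every letter has positive mass and that five empirical averages are close
    to their means. Chebyshev's inequality then suffices, and the union bounds over exponentially
    many blocks are beaten by doubly exponentially small failure probabilities.

    In the converse, U_i contains V^(i-1) so that Decoder 2 is a function of U_i and V_i alone. Its
    alphabet grows with n and must become one fixed alphabet before a limit can be taken. Conic
    weights suffice for this, since all functionals involved are homogeneous of degree one in the
    slices of the law at each u. *)

Section ProductWeights.
Variable R : realType.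

Lemma sum_prod_indep (I T : finType) (F : I -> T -> R) :
  \sum_(z : {ffun I -> T}) \prod_i F i (z i) = \prod_i \sum_t F i t.
Proof. by rewrite bigA_distr_bigA. Qed.

(** Expand the square: a cross term factors over the coordinates and contains a vanishing mean, so
    only the diagonal terms survive. *)
Lemma prod_weight_moment2 (I T : finType) (p : T -> R) (f : T -> R) :
  \sum_t p t = 1 -> \sum_t p t * f t = 0 ->
  \sum_(z : {ffun I -> T}) (\prod_i p (z i)) * (\sum_i f (z i)) ^+ 2 =
  #|I|%:R * \sum_t p t * f t ^+ 2.
Proof.
move=> p1 pf0.
(* Attaching the factors [f] to the coordinates [i] and [j] makes each term of the double sum a
   product over all coordinates. *)
pose g (i j l : I) (t : T) := p t * ((if l == i then f t else 1) * (if l == j then f t else 1)).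
have E (z : {ffun I -> T}) :
  (\prod_i p (z i)) * (\sum_i f (z i)) ^+ 2 = \sum_i \sum_j \prod_l g i j l (z l).
  rewrite expr2 mulr_suml mulr_sumr; apply: eq_bigr => i _.
  rewrite mulr_sumr mulr_sumr; apply: eq_bigr => j _.
  rewrite !big_split /= -!big_mkcond /= !big_pred1_eq; ring.
rewrite (eq_bigr _ (fun z _ => E z)) exchange_big /=.
transitivity (\sum_(i : I) \sum_t p t * f t ^+ 2); last by rewrite sumr_const mulr_natl.
apply: eq_bigr => i _; rewrite exchange_big /= (bigD1 i) //= [X in _ + X]big1 => [|j ji].
  rewrite addr0 (sum_prod_indep (g i i)) (bigD1 i) //= [X in _ * X]big1 => [|l li].
    by rewrite mulr1; apply: eq_bigr => t _; rewrite /g eqxx expr2.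
  by rewrite -[RHS]p1; apply: eq_bigr => t _; rewrite /g (negbTE li) !mulr1.
rewrite (sum_prod_indep (g i j)) (bigD1 i) //= (_ : \sum_t _ = 0) ?mul0r // -[RHS]pf0.
by apply: eq_bigr => t _; rewrite /g eqxx eq_sym (negbTE ji) mulr1.
Qed.

Lemma prod_weight_chebyshev (I T : finType) (p : T -> R) (f : T -> R) (eta : R) :
  (forall t, 0 <= p t) -> \sum_t p t = 1 -> 0 < eta -> (0 < #|I|)%N ->
  \sum_(z : {ffun I -> T} |
        eta * #|I|%:R < `|\sum_i f (z i) - #|I|%:R * \sum_t p t * f t|)
     \prod_i p (z i)
  <= (\sum_t p t * (f t - \sum_t p t * f t) ^+ 2) / (#|I|%:R * eta ^+ 2).
Proof.
move=> p0 p1 eta0 I0; set mu := \sum_t p t * f t.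
pose g t := f t - mu.
have N0 : 0 < #|I|%:R :> R by rewrite ltr0n.
have pg : \sum_t p t * g t = 0.
  under eq_bigr do rewrite mulrBr.
  by rewrite sumrB -mulr_suml p1 mul1r subrr.
have := prod_weight_moment2 I p1 pg => M2.
rewrite ler_pdivlMr; last by rewrite mulr_gt0 ?exprn_gt0.
rewrite -(ler_pM2l N0) -M2.
have E (z : {ffun I -> T}) : \sum_i f (z i) - #|I|%:R * mu = \sum_i g (z i).
  by rewrite /g sumrB sumr_const mulr_natl.
rewrite [leRHS](bigID (fun z : {ffun I -> T} => eta * #|I|%:R < `|\sum_i g (z i)|)) /=.
rewrite -[leLHS]addr0 lerD //; last first.
  by apply: sumr_ge0 => z _; rewrite mulr_ge0 ?sqr_ge0 // prodr_ge0.
rewrite (eq_bigl (fun z : {ffun I -> T} => eta * #|I|%:R < `|\sum_i g (z i)|)); last first.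
  by move=> z; rewrite E.
rewrite mulrCA mulr_suml; apply: ler_sum => z Hz.
rewrite ler_wpM2l ?prodr_ge0 // mulrA -expr2 -exprMn -[leRHS](real_normK (num_real _)).
rewrite lerXn2r ?nnegrE ?normr_ge0 ?mulr_ge0 ?ler0n ?(ltW eta0) //.
by rewrite mulrC ltW.
Qed.

Lemma one_subr_expn_le (x : R) n : x <= 1 -> (1 - x) ^+ n <= expR (- (x * n%:R)).
Proof.
move=> x1; rewrite -mulNr expRM_natr lerXn2r ?nnegrE ?subr_ge0 ?expR_ge0 //.
by rewrite -[1 - x]/(1 + - x) expR_ge1Dx.
Qed.

(* Probabilistic method: draw the values of [c] independently from [q]; the event
   indexed by [e] fails with probability [(1 - q (W e)) ^ #|S e|]. *)
Lemma exists_hitting_function (I T E : finType) (q : T -> R)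
    (S : E -> pred I) (W : E -> pred T) :
  (forall t, 0 <= q t) -> \sum_t q t = 1 ->
  \sum_e expR (- ((\sum_(t | W e t) q t) * #|S e|%:R)) < 1 ->
  exists c : {ffun I -> T}, forall e, exists2 i, S e i & W e (c i).
Proof.
move=> q0 q1 small.
pose miss (e : E) (c : {ffun I -> T}) := [forall i, S e i ==> ~~ W e (c i)].
have missP e : \sum_(c | miss e c) \prod_i q (c i) <=
    expR (- ((\sum_(t | W e t) q t) * #|S e|%:R)).
  have -> : \sum_(c | miss e c) \prod_i q (c i) =
      \sum_(c : {ffun I -> T}) \prod_i (if S e i && W e (c i) then 0 else q (c i)).
    rewrite big_mkcond; apply: eq_bigr => c _; case: ifP => [/forallP H|].
      apply: eq_bigr => i _; case: ifP => // /andP[Si Wi].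
      by have := H i; rewrite Si Wi.
    move=> /negbT; rewrite negb_forall => /existsP[i].
    rewrite negb_imply negbK => Hi.
    by rewrite (bigD1 i) //= Hi mul0r.
  rewrite (sum_prod_indep (fun i t => if S e i && W e t then 0 else q t)).
  have W1 : \sum_(t | W e t) q t <= 1.
    rewrite -q1 [leRHS](bigID (W e)) /= lerDl sumr_ge0 //.
  apply: le_trans (one_subr_expn_le _ W1).
  rewrite (bigID (S e)) /= [X in _ * X]big1 => [|i /negbTE Si]; last first.
    by rewrite -[RHS]q1; apply: eq_bigr => t _; rewrite Si.
  rewrite mulr1 (eq_bigr (fun=> 1 - \sum_(t | W e t) q t)); first by rewrite prodr_const.
  move=> i Si; rewrite -q1 [in RHS](bigID (W e)) /= [RHS]addrC addKr.
  by rewrite [RHS]big_mkcond; apply: eq_bigr => t _; rewrite Si; case: (W e t).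
(* Union bound: if every [c] missed some event, the miss probabilities would add up to at least
   1. *)
have [c Hc] : exists c, ~~ [exists e, miss e c].
  apply/existsP; rewrite -negb_forall; apply/negP => /forallP all_miss.
  have : 1 <= \sum_e \sum_(c | miss e c) \prod_i q (c i).
    rewrite (eq_bigr _ (fun e _ => big_mkcond _ _)) exchange_big /=.
    apply: (@le_trans _ _ (\sum_(c : {ffun I -> T}) \prod_i q (c i))).
      by rewrite (sum_prod_indep (fun=> q)) big1.
    apply: ler_sum => c _; have /existsP[e He] := all_miss c.
    rewrite [leRHS](bigD1 e) //= He lerDl sumr_ge0 // => e' _.
    by case: ifP => // _; rewrite prodr_ge0.
  apply/negP; rewrite -ltNge; apply: le_lt_trans small.
  by apply: ler_sum => e _; exact: missP.
exists c => e; move: Hc; rewrite negb_exists => /forallP/(_ e).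
rewrite negb_forall => /existsP[i]; rewrite negb_imply negbK => /andP[Si Wi].
by exists i.
Qed.

End ProductWeights.

(** * Random covering and random colouring *)

Section OneShot.
Variable R : realType.

(** Serves to pass from a small bad mass of triples to a small bad mass of pairs and then of points
    [x]; each passage costs a factor 2. *)
Lemma bad_half_le (T : finType) (w : T -> R) (P : pred T) :
  (forall t, 0 <= w t) -> ~~ ((0 < \sum_t w t) && (\sum_t w t <= 2 * \sum_(t | P t) w t)) ->
  \sum_t w t <= 2 * \sum_(t | ~~ P t) w t.
Proof.
move=> w0; have p0 : 0 <= \sum_(t | ~~ P t) w t by exact: sumr_ge0.
rewrite (bigID P) /=; case: ltP => /= [_|]; first by rewrite -ltNge; lra.
by move=> H _; apply: le_trans H _; lra.
Qed.

Lemma sum_le_card (E : finType) (F : E -> R) (c : R) :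
  (forall e, F e <= c) -> \sum_e F e <= #|E|%:R * c.
Proof.
move=> Fc; apply: (@le_trans _ _ (\sum_(e : E) c)); first exact: ler_sum.
by rewrite sumr_const mulr_natl.
Qed.

(** Codewords are drawn from the marginal [Wu] and colours uniformly. For a good [x], a codeword
    falls in [A x] with probability at least 1/(2 alpha). For a pair in [A], at least kappa/2 values
    [v] are compatible, and all of them miss a given colour with probability at most
    exp(-kappa/(2K)). The smallness hypotheses are the two union bounds. The case K = 1 is separate
    because a single colour needs only one compatible [v], however small [kappa] is. *)
Lemma one_shot_code (X V U : finType) (W : X -> V -> U -> R) (T : X -> V -> pred U)
    (eps alpha kappa : R) (M K : nat) :
  let Wxu x u := \sum_v W x v u in
  let Wx x := \sum_u Wxu x u in
  let Wu u := \sum_x Wxu x u in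
  (forall x v u, 0 <= W x v u) -> \sum_x Wx x = 1 ->
  \sum_x \sum_u \sum_(v | ~~ T x v u) W x v u <= eps ->
  0 < alpha -> 0 < kappa -> (0 < K)%N ->
  (forall x v u, T x v u -> Wxu x u <= Wx x * Wu u * alpha) ->
  (forall x v u, T x v u -> W x v u * kappa <= Wxu x u) ->
  #|X|%:R * expR (- (M%:R / (2 * alpha))) < 1 ->
  (K = 1%N \/ #|X|%:R * #|U|%:R * K%:R * expR (- (kappa / (2 * K%:R))) < 1) ->
  exists (code : 'I_M -> U) (col : V -> 'I_K) (G : pred X),
    \sum_(x | ~~ G x) Wx x <= 4 * eps /\
    forall x, G x -> exists m, forall k, exists2 v, T x v (code m) & col v = k.
Proof.
move=> Wxu Wx Wu W0 W1 Weps a0 k0 K0 Ta Tk smallM smallK.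
have Wxu0 x u : 0 <= Wxu x u by exact: sumr_ge0.
have Wx0 x : 0 <= Wx x by exact: sumr_ge0.
have Wu0 u : 0 <= Wu u by exact: sumr_ge0.
pose A x u := (0 < Wxu x u) && (Wxu x u <= 2 * \sum_(v | T x v u) W x v u).
pose G x := (0 < Wx x) && (Wx x <= 2 * \sum_(u | A x u) Wxu x u).
have AT x u : A x u -> exists v, T x v u.
  case/andP=> p0 p1; apply/existsP; rewrite -[X in is_true X]negbK negb_exists.
  apply/negP => /forallP nT; have := lt_le_trans p0 p1.
  by rewrite big1 ?mulr0 ?ltxx // => v Tv; have := nT v; rewrite Tv.
(* A compatible [v] carries at most the fraction 1/kappa of the mass of (x,u), and together they
   carry at least half of it. *)
have Acard x u : A x u -> kappa / 2 <= #|[pred v | T x v u]|%:R.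
  move=> /andP[p0 p1]; rewrite ler_pdivrMr // -(ler_pM2l p0).
  have : \sum_(v | T x v u) W x v u * kappa <= \sum_(v | T x v u) Wxu x u.
    by apply: ler_sum => v; exact: Tk.
  rewrite -mulr_suml sumr_const -[X in _ <= X]mulr_natr => H.
  by have := ler_wpM2r (ltW k0) p1; rewrite -mulrA; lra.
(* At least half of the mass of [x] lies over [A x], and there [Ta] bounds the joint weight by alpha
   times the product weight. *)
have Gcov x : G x -> (2 * alpha)^-1 <= \sum_(u | A x u) Wu u.
  move=> /andP[p0 p1].
  rewrite -div1r ler_pdivrMr ?mulr_gt0 // -(ler_pM2l p0).
  have : \sum_(u | A x u) Wxu x u <= \sum_(u | A x u) Wx x * Wu u * alpha.
    by apply: ler_sum => u /AT[v]; exact: Ta.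
  by rewrite -mulr_suml -mulr_sumr; lra.
have sig_card (E : finType) (P : pred E) : #|{: {e | P e}}|%:R <= #|E|%:R :> R.
  by rewrite ler_nat card_sig max_card.
have [||code Hcode] := @exists_hitting_function R 'I_M U {x | G x} Wu
    (fun=> predT) (fun x => A (sval x)) Wu0.
- by rewrite exchange_big /=; exact: W1.
- apply: le_lt_trans smallM; apply: le_trans (ler_wpM2r (expR_ge0 _) (sig_card _ G)).
  apply: sum_le_card => -[x Gx] /=.
  rewrite ler_expR lerN2 cardT size_enum_ord mulrC ler_wpM2r ?ler0n //.
  exact: Gcov.
have [col Hcol] : exists col : V -> 'I_K, forall x u k, A x u ->
    exists2 v, T x v u & col v = k.
  case: smallK => [K1|smallK].
    subst K; exists (fun=> ord0) => x u k /AT[v Tv]; exists v => //.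
    by rewrite /= [k]ord1.
  have K0r : 0 < K%:R :> R by rewrite ltr0n.
  pose E : finType := ({xu : X * U | A xu.1 xu.2} * 'I_K)%type.
  have [|||col Hcol] := @exists_hitting_function R V 'I_K E (fun=> K%:R^-1)
    (fun e v => T (sval e.1).1 v (sval e.1).2) (fun e => pred1 e.2).
  + by move=> _; rewrite invr_ge0 ltW.
  + by rewrite sumr_const card_ord -[LHS]mulr_natl mulfV ?gt_eqF.
  + apply: le_lt_trans smallK.
    have card_le : #|E|%:R <= #|X|%:R * #|U|%:R * K%:R :> R.
      rewrite card_prod card_ord natrM ler_wpM2r ?ler0n // -natrM -card_prod.
      exact: sig_card.
    apply: le_trans (ler_wpM2r (expR_ge0 _) card_le).
    apply: sum_le_card => -[[[x u] Axu] k] /=.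
    rewrite ler_expR lerN2 big_pred1_eq invfM mulrA mulrC ler_wpM2l ?invr_ge0 ?(ltW K0r) //.
    exact: Acard.
  exists col => x u k Axu.
  have [v Tv /eqP ck] := Hcol (exist _ (x, u) Axu, k).
  by exists v.
exists code, col, G; split; last first.
  move=> x Gx; have [m _ Am] := Hcode (exist _ x Gx).
  by exists m => k; exact: Hcol.
have s1 x : \sum_(u | ~~ A x u) Wxu x u <= 2 * \sum_u \sum_(v | ~~ T x v u) W x v u.
  rewrite mulr_sumr big_mkcond; apply: ler_sum => u _; case: ifP => [nA|_].
    exact: bad_half_le.
  by rewrite mulr_ge0 // sumr_ge0.
apply: (@le_trans _ _ (\sum_x 4 * \sum_u \sum_(v | ~~ T x v u) W x v u)); last first.
  by rewrite -mulr_sumr ler_pM2l.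
rewrite big_mkcond; apply: ler_sum => x _; case: ifP => [nG|_]; last first.
  by rewrite mulr_ge0 // !sumr_ge0 // => u _; rewrite sumr_ge0.
have := bad_half_le (Wxu0 x) nG; rewrite -/(Wx x) => H; have := s1 x; lra.
Qed.

End OneShot.

(** * Block-Markov coding *)

Section IidMarginal.
Variables (R : realType) (X : finType) (PX : {ffun X -> R}).
Hypothesis PXpmf : is_pmf PX.

Lemma iid_ge0 n (x : n.-tuple X) : 0 <= iid PX x.
Proof. by apply: prodr_ge0 => j _; case: PXpmf. Qed.

Lemma big_tuple_ffun n (F : n.-tuple X -> R) :
  \sum_x F x = \sum_(y : {ffun 'I_n -> X}) F [tuple y j | j < n].
Proof.
rewrite (reindex (fun y : {ffun 'I_n -> X} => [tuple y j | j < n])) //=.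
exists (fun x : n.-tuple X => [ffun j => tnth x j]) => [y _|x _].
  by apply/ffunP => j; rewrite ffunE tnth_mktuple.
by apply: eq_from_tnth => j; rewrite tnth_mktuple ffunE.
Qed.

(** Positions outside the image of [h] sum to 1, and by injectivity each position inside it carries
    one condition. Blocks are read off a long sequence in this way. *)
Lemma iid_marginal n N (h : 'I_N -> 'I_n) (F : {ffun 'I_N -> X} -> R) :
  injective h ->
  \sum_(x : n.-tuple X) iid PX x * F [ffun i => tnth x (h i)] =
  \sum_(y : {ffun 'I_N -> X}) (\prod_i PX (y i)) * F y.
Proof.
move=> hinj; rewrite big_tuple_ffun.
pose r (x : {ffun 'I_n -> X}) : {ffun 'I_N -> X} := [ffun i => x (h i)].
rewrite (partition_big r predT) //=; apply: eq_bigr => y _.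
transitivity ((\sum_(x : {ffun 'I_n -> X} | r x == y) \prod_j PX (x j)) * F y).
  rewrite mulr_suml; apply: eq_bigr => x /eqP <-; congr (_ * F _).
    by apply: eq_bigr => j _; rewrite tnth_mktuple.
  by apply/ffunP => i; rewrite !ffunE tnth_mktuple.
congr (_ * _).
(* The condition that [x] restricts to [y] is written as indicators attached to the positions, so
   that the sum over [x] factorises. *)
pose g j t : R := PX t * \prod_(i | h i == j) (t == y i)%:R.
transitivity (\sum_(x : {ffun 'I_n -> X}) \prod_j g j (x j)).
  rewrite big_mkcond; apply: eq_bigr => x _.
  rewrite big_split /= -[X in if _ then X else _]mulr1 -[X in if _ then _ else X](mulr0 (\prod_j PX (x j))).
  rewrite -fun_if; congr (_ * _).
  transitivity (\prod_i (x (h i) == y i)%:R : R); last first.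
    rewrite [LHS](partition_big h predT) //=.
    by apply: eq_bigr => j _; apply: eq_bigr => i /eqP ->.
  case: eqP => [<-|/eqP ne]; first by rewrite big1 // => i _; rewrite ffunE eqxx.
  have [i Hi] : exists i, x (h i) != y i.
    apply/existsP; rewrite -negb_forall; apply: contra ne => /forallP H.
    by apply/eqP/ffunP => i; rewrite ffunE; apply/eqP.
  by rewrite (bigD1 i) //= (negbTE Hi) mul0r.
rewrite (sum_prod_indep g).
transitivity (\prod_j \prod_(i | h i == j) PX (y i)); last first.
  by rewrite [RHS](partition_big h predT).
apply: eq_bigr => j _.
have [/existsP[i /eqP hi]|nj] := boolP [exists i, h i == j].
  have E i' : (h i' == j) = (i' == i) by rewrite -hi (inj_eq hinj).
  rewrite (eq_bigl _ _ E) big_pred1_eq (bigD1 (y i)) //= [X in _ + X]big1; last first.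
    by move=> t /negbTE ty; rewrite /g (eq_bigl _ _ E) big_pred1_eq ty mulr0.
  by rewrite addr0 /g (eq_bigl _ _ E) big_pred1_eq eqxx mulr1.
have E i : (h i == j) = false by apply/negbTE; move: nj; rewrite negb_exists => /forallP.
rewrite big_pred0 //; case: PXpmf => _ <-; apply: eq_bigr => t _.
by rewrite /g big_pred0 ?mulr1.
Qed.

Lemma sum_iid n : \sum_(x : n.-tuple X) iid PX x = 1.
Proof.
have := @iid_marginal n 0 (fun i => widen_ord (leq0n n) i) (fun=> 1).
rewrite (eq_bigr _ (fun x _ => mulr1 _)) => ->; last by case.
rewrite (eq_bigr (fun=> 1)) => [|y _]; last by rewrite big_ord0 mulr1.
by rewrite sumr_const card_ffun card_ord expn0.
Qed.

Lemma iid_marginal1 n (j : 'I_n) (F : X -> R) :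
  \sum_(x : n.-tuple X) iid PX x * F (tnth x j) = \sum_t PX t * F t.
Proof.
have := @iid_marginal n 1 (fun=> j) (fun y => F (y ord0)).
under eq_bigr do rewrite ffunE.
move=> ->; last by move=> i i'; rewrite [i]ord1 [i']ord1.
rewrite (reindex (fun t : X => [ffun _ : 'I_1 => t])) /=; last first.
  exists (fun y : {ffun 'I_1 -> X} => y ord0) => [t _|y _]; first by rewrite ffunE.
  by apply/ffunP => i; rewrite ffunE [i]ord1.
by apply: eq_bigr => t _; rewrite big_ord1 !ffunE.
Qed.

End IidMarginal.

Section BlockMarkov.
Variables (R : realType) (X X1 X2 U : finType) (PX : {ffun X -> R}).
Hypothesis PXpmf : is_pmf PX.
Variables (B N : nat).
Hypotheses (B0 : (0 < B)%N) (N0 : (0 < N)%N).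

Lemma block_index_subproof (b : 'I_B) (i : 'I_N) : (b * N + i < B * N)%N.
Proof.
apply: (@leq_trans (b.+1 * N)); first by rewrite mulSn addnC ltn_add2r.
by rewrite leq_mul2r ltn_ord orbT.
Qed.
Definition block_index b i : 'I_(B * N) := Ordinal (block_index_subproof b i).

Lemma block_of_subproof (j : 'I_(B * N)) : (j %/ N < B)%N.
Proof. by rewrite ltn_divLR. Qed.
Definition block_of j : 'I_B := Ordinal (block_of_subproof j).

Lemma offset_of_subproof (j : 'I_(B * N)) : (j %% N < N)%N.
Proof. by rewrite ltn_pmod. Qed.
Definition offset_of j : 'I_N := Ordinal (offset_of_subproof j).

Lemma block_of_index b i : block_of (block_index b i) = b.
Proof. by apply: val_inj; rewrite /= divnMDl // divn_small // addn0. Qed.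

Lemma offset_of_index b i : offset_of (block_index b i) = i.
Proof. by apply: val_inj; rewrite /= modnMDl modn_small. Qed.

Lemma block_indexK j : block_index (block_of j) (offset_of j) = j.
Proof. by apply: val_inj; rewrite /= -divn_eq. Qed.

Lemma sum_blocks (F : 'I_(B * N) -> R) :
  \sum_j F j = \sum_b \sum_i F (block_index b i).
Proof.
rewrite pair_big /= (reindex (fun p : 'I_B * 'I_N => block_index p.1 p.2)) //=.
exists (fun j => (block_of j, offset_of j)) => [[b i] _|j _] /=.
  by rewrite block_of_index offset_of_index.
exact: block_indexK.
Qed.

Definition block (T : finType) (b : 'I_B) (x : (B * N).-tuple T) : {ffun 'I_N -> T} :=
  [ffun i => tnth x (block_index b i)].

(** A bad block costs at most [dmax] per letter, and every block has the same product law. Averaging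
    over the blocks leaves the probability of a single bad block, whatever [B] is. *)
Lemma exp_dist_blocks (Y : finType) (d : X -> Y -> R) (rec : (B * N).-tuple X -> 'I_(B * N) -> Y)
    (G : pred {ffun 'I_N -> X}) (D dmax : R) :
  0 <= D -> 0 <= dmax -> (forall a y, d a y <= dmax) ->
  (forall x b, G (block b x) ->
     \sum_i d (tnth x (block_index b i)) (rec x (block_index b i)) <= N%:R * D) ->
  exp_dist PX d rec <= D + dmax * \sum_(y : {ffun 'I_N -> X} | ~~ G y) \prod_i PX (y i).
Proof.
move=> D0 dm0 dmax_ge Hgood.
pose bad y : R := (~~ G y)%:R.
have N0r : 0 < N%:R :> R by rewrite ltr0n.
have B0r : 0 < B%:R :> R by rewrite ltr0n.
apply: (@le_trans _ _ (\sum_(x : (B * N).-tuple X)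
    iid PX x * (B%:R^-1 * \sum_b (D + dmax * bad (block b x))))).
  apply: ler_sum => x _; rewrite ler_wpM2l ?iid_ge0 //.
  rewrite natrM invfM -mulrA ler_wpM2l ?invr_ge0 ?(ltW B0r) //.
  rewrite sum_blocks mulr_sumr; apply: ler_sum => b _.
  rewrite mulrC ler_pdivrMr // mulrC /bad.
  case: (boolP (G _)) => [Gb|nG]; first by rewrite mulr0 addr0 Hgood.
  rewrite mulr1; apply: (@le_trans _ _ (\sum_(i < N) dmax)).
    by apply: ler_sum => i _; exact: dmax_ge.
  by rewrite sumr_const card_ord -[leLHS]mulr_natl ler_pM2l // lerDr.
under eq_bigr do rewrite mulrCA mulr_sumr.
rewrite -mulr_sumr exchange_big /= mulrC ler_pdivrMr //.
rewrite (eq_bigr (fun=> D + dmax * \sum_(y | ~~ G y) \prod_i PX (y i))).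
  by rewrite sumr_const card_ord mulr_natr.
move=> b _.
have binj : injective (block_index b).
  by move=> i i' /(congr1 offset_of); rewrite !offset_of_index.
under eq_bigr do rewrite mulrDr mulrCA.
rewrite big_split /= -mulr_suml -mulr_sumr sum_iid // mul1r; congr (_ + _ * _).
rewrite (iid_marginal PXpmf bad binj) [RHS]big_mkcond /=.
by apply: eq_bigr => y _; rewrite /bad; case: (G y); rewrite ?mulr0 ?mulr1.
Qed.

End BlockMarkov.

Section BlockMarkovCode.
Variables (R : realType) (X X1 X2 U : finType) (PX : {ffun X -> R}).
Hypothesis PXpmf : is_pmf PX.

Lemma ord_code (T : finType) m : #|T| = m ->
  exists (e : T -> 'I_m) (e' : 'I_m -> T), cancel e e'.
Proof.
by move=> <-; exists enum_rank, enum_val; exact: enum_rankK.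
Qed.

(* Block [b] uses the codeword number [mu y_b = a_b * K + k_b]. The quotients [a_b] and the
   remainder [k_0] of the first block are sent as common message; the other remainders
   are colours: [col v_b = k_(b+1)], so that a decoder knowing the block [v_b] of the first
   reconstruction also knows the codeword of the next block. *)
Lemma block_markov_code (B N M K A L : nat)
    (code : 'I_M -> {ffun 'I_N -> U}) (col : {ffun 'I_N -> X1} -> 'I_K)
    (mu : {ffun 'I_N -> X} -> 'I_M)
    (nu : {ffun 'I_N -> X} -> 'I_K -> {ffun 'I_N -> X1})
    (Q : {ffun 'I_N -> U} -> {set {ffun 'I_N -> X1}})
    (G : pred {ffun 'I_N -> X}) (f : U -> X1 -> X2)
    (d1 : X -> X1 -> R) (d2 : X -> X2 -> R) (D1 D2 dmax : R) :
  (0 < B)%N -> (0 < N)%N -> (M <= A * K)%N ->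
  (forall u, #|Q u| <= L)%N ->
  (forall y k, col (nu y k) = k) -> (forall y k, nu y k \in Q (code (mu y))) ->
  0 <= D1 -> 0 <= D2 -> 0 <= dmax ->
  (forall a b, d1 a b <= dmax) -> (forall a b, d2 a b <= dmax) ->
  (forall y k, G y -> \sum_i d1 (y i) (nu y k i) <= N%:R * D1) ->
  (forall y k, G y ->
     \sum_i d2 (y i) (f (code (mu y) i) (nu y k i)) <= N%:R * D2) ->
  let bad := \sum_(y : {ffun 'I_N -> X} | ~~ G y) \prod_i PX (y i) in
  exists (f0 : (B * N).-tuple X -> 'I_(A ^ B * K)) (f1 : (B * N).-tuple X -> 'I_(L ^ B))
         (g1 : 'I_(A ^ B * K) -> 'I_(L ^ B) -> (B * N).-tuple X1)
         (g2 : 'I_(B * N) -> 'I_(A ^ B * K) -> seq X1 -> X2),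
    let xh1 := fun x => g1 (f0 x) (f1 x) in
    exp_dist PX d1 (fun x j => tnth (xh1 x) j) <= D1 + dmax * bad /\
    exp_dist PX d2 (fun x j => g2 j (f0 x) (take j.+1 (val (xh1 x)))) <= D2 + dmax * bad.
Proof.
move=> B0 N0 MAK QL colnu nuQ D10 D20 dm0 dm1 dm2 G1 G2 bad.
have [x0 _] : exists x0 : X, true.
  case: (pickP (fun _ : X => true)) => [x0 _|X0]; first by exists x0.
  by case: PXpmf => _; rewrite big_pred0 // => /esym/eqP; rewrite oner_eq0.
pose y0 : {ffun 'I_N -> X} := [ffun=> x0].
have AK0 : (0 < A * K)%N by exact: leq_ltn_trans (leq0n _) (leq_trans (ltn_ord (mu y0)) MAK).
have K0 : (0 < K)%N by move: AK0; rewrite muln_gt0 => /andP[].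
have quo_lt (m : 'I_M) : (m %/ K < A)%N by rewrite ltn_divLR // (leq_trans _ MAK).
pose quo m : 'I_A := Ordinal (quo_lt m).
pose rem (m : 'I_M) : 'I_K := Ordinal (ltn_pmod m K0).
pose b0 : 'I_B := Ordinal B0.
pose ms (x : (B * N).-tuple X) b := mu (block b x).
(* The successor [ordS] is cyclic: the last block carries the remainder of the first one, which is a
   mere default since that remainder is transmitted anyway. *)
pose vs x b := nu (block b x) (rem (ms x (ordS b))).
have rk_lt x b : (index (vs x b) (enum (Q (code (ms x b)))) < L)%N.
  by apply: leq_trans (QL (code (ms x b))); rewrite cardE index_mem mem_enum nuQ.
pose T0 : finType := ({ffun 'I_B -> 'I_A} * 'I_K)%type.
pose T1 : finType := {ffun 'I_B -> 'I_L}.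
pose c0 (x : (B * N).-tuple X) : T0 := ([ffun b => quo (ms x b)], rem (ms x b0)).
pose c1 (x : (B * N).-tuple X) : T1 := [ffun b => Ordinal (rk_lt x b)].
pose xh x : (B * N).-tuple X1 :=
  [tuple vs x (block_of N0 j) (offset_of N0 j) | j < B * N].
have blk_xh x b : block b (xh x) = vs x b.
  by apply/ffunP => i; rewrite ffunE tnth_mktuple block_of_index offset_of_index.
have ms_eq x b : ms x b = (quo (ms x b) * K + rem (ms x b))%N :> nat.
  exact: divn_eq.
have rem_succ x (b b' : 'I_B) : val b = b'.+1 -> rem (ms x b) = col (vs x b').
  move=> bb'; rewrite /vs colnu; congr (rem (ms x _)); apply: val_inj.
  by rewrite /= -bb' modn_small ?ltn_ord.
(* Induction along the blocks: a known remainder completes the codeword index, the rank then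
   identifies the block [v], and its colour is the next remainder. Hence Decoder 1 may answer with
   the reconstruction of any source sequence that has the received messages. *)
have xh_inj x x' : c0 x = c0 x' -> c1 x = c1 x' -> xh x = xh x'.
  move=> [/ffunP qE rE] /ffunP iE.
  suff vE b : vs x b = vs x' b by apply: eq_from_tnth => j; rewrite !tnth_mktuple vE.
  suff remE b' : rem (ms x b') = rem (ms x' b') -> vs x b' = vs x' b'.
    case: b => b; elim: b => [|b IH] bB.
      by apply: remE; rewrite (_ : Ordinal bB = b0) //; exact: val_inj.
    apply: remE; rewrite !(@rem_succ _ _ (Ordinal (ltnW bB))) //.
    by rewrite IH.
  move=> rE'; have mE : ms x b' = ms x' b'.
    by apply: val_inj; have := qE b'; rewrite !ffunE /= => qE';
       rewrite [LHS]ms_eq [RHS]ms_eq qE' rE'.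
  have := congr1 (@nat_of_ord _) (iE b'); rewrite !ffunE /= mE => idx.
  have n1 := nth_index (vs x b') (s := enum (Q (code (ms x' b')))) (x := vs x b').
  have n2 := nth_index (vs x b') (s := enum (Q (code (ms x' b')))) (x := vs x' b').
  rewrite -n1; last by rewrite mem_enum -mE nuQ.
  by rewrite -[RHS]n2 ?idx // mem_enum nuQ.
have [e0 [e0' e0K]] : exists (e : T0 -> 'I_(A ^ B * K)) (e' : 'I_(A ^ B * K) -> T0), cancel e e'.
  by apply: ord_code; rewrite card_prod card_ffun !card_ord.
have [e1 [e1' e1K]] : exists (e : T1 -> 'I_(L ^ B)) (e' : 'I_(L ^ B) -> T1), cancel e e'.
  by apply: ord_code; rewrite card_ffun !card_ord.
pose v0 := vs [tuple x0 | j < B * N] b0 (Ordinal N0).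
pose g1 t0 t1 := if [pick x | (c0 x == e0' t0) && (c1 x == e1' t1)] is Some x
  then xh x else xh [tuple x0 | j < B * N].
have g1E x : g1 (e0 (c0 x)) (e1 (c1 x)) = xh x.
  rewrite /g1 e0K e1K; case: pickP => [x' /andP[/eqP h0 /eqP h1]|/(_ x)].
    exact: xh_inj.
  by rewrite !eqxx.
pose dec_col b (s : seq X1) :=
  col [ffun i : 'I_N => nth v0 s (b.-1 * N + i)].
pose dec_k (b : 'I_B) (t : T0) s : 'I_K := if (val b == 0)%N then t.2 else dec_col b s.
(* On messages produced by the encoder the number is an index below [M], and the default [mu y0] is
   not reached. *)
pose dec_m b (t : T0) s : 'I_M := insubd (mu y0) (t.1 b * K + dec_k b t s)%N.
pose g2 (j : 'I_(B * N)) t0 s :=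
  f (code (dec_m (block_of N0 j) (e0' t0) s) (offset_of N0 j)) (nth v0 s j).
(* A position [j] of block b is at least bN, so the prefix of length j+1 contains the whole of block
   b-1, whose colour is the wanted remainder. *)
have dec_kE x (j : 'I_(B * N)) :
    dec_k (block_of N0 j) (c0 x) (take j.+1 (xh x)) = rem (ms x (block_of N0 j)).
  set b := block_of N0 j; rewrite /dec_k; case: ifPn => [/eqP b00|bn0].
    by rewrite (_ : b = b0) //; exact: val_inj.
  have bB : (b.-1 < B)%N by apply: leq_ltn_trans (leq_pred _) (ltn_ord b).
  rewrite (@rem_succ _ _ (Ordinal bB)); last by rewrite prednK // lt0n.
  congr col; rewrite -blk_xh; apply/ffunP => i; rewrite ffunE [RHS]ffunE nth_take.
    by rewrite (tnth_nth v0).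
  rewrite ltnS (leq_trans _ (leq_trunc_div j N)) // -[X in (_ <= X * _)%N]prednK ?lt0n //.
  by rewrite mulSn addnC leq_add2r ltnW.
have dec_mE x (j : 'I_(B * N)) :
    dec_m (block_of N0 j) (c0 x) (take j.+1 (xh x)) = ms x (block_of N0 j).
  rewrite /dec_m dec_kE; apply: val_inj.
  by rewrite val_insubd ffunE -[X in if (X < _)%N then X else _]ms_eq ltn_ord.
exists (e0 \o c0), (e1 \o c1), g1, g2 => /=.
split; apply: (exp_dist_blocks PXpmf B0 N0) => // x b Gb.
- apply: le_trans (G1 _ (rem (ms x (ordS b))) Gb); rewrite le_eqVlt; apply/orP; left; apply/eqP.
  apply: eq_bigr => i _; rewrite g1E ffunE; congr (d1 _ _).
  by rewrite -[RHS]/(vs x b i) -blk_xh ffunE.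
- apply: le_trans (G2 _ (rem (ms x (ordS b))) Gb); rewrite le_eqVlt; apply/orP; left; apply/eqP.
  apply: eq_bigr => i _; rewrite g1E ffunE; congr (d2 _ _).
  rewrite /g2 e0K dec_mE block_of_index offset_of_index; congr (f _ _).
  rewrite -[RHS]/(vs x b i) -blk_xh ffunE nth_take //.
  by rewrite (tnth_nth v0).
Qed.

End BlockMarkovCode.

(** * Entropy *)

Section Entropy.
Variable R : realType.

Lemma ln2_gt0 : 0 < ln 2 :> R.
Proof. by rewrite ln_gt0 // ltr1n. Qed.

Lemma log2M (x y : R) : 0 < x -> 0 < y -> log2 (x * y) = log2 x + log2 y.
Proof. by move=> x0 y0; rewrite /log2 lnM ?posrE // mulrDl. Qed.

Lemma log2V (x : R) : 0 < x -> log2 x^-1 = - log2 x.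
Proof. by move=> x0; rewrite /log2 lnV ?posrE // mulNr. Qed.

Lemma log2_div (x y : R) : 0 < x -> 0 < y -> log2 (x / y) = log2 x - log2 y.
Proof. by move=> x0 y0; rewrite log2M ?invr_gt0 // log2V. Qed.

Lemma log2_1 : log2 1 = 0 :> R.
Proof. by rewrite /log2 ln1 mul0r. Qed.

Lemma sum_pair (A B : finType) (F : A * B -> R) :
  \sum_p F p = \sum_a \sum_b F (a, b).
Proof. by rewrite pair_bigA; apply: eq_bigr => -[]. Qed.

Lemma sum_option (A : finType) (F : option A -> R) :
  \sum_o F o = F None + \sum_a F (Some a).
Proof.
rewrite (bigD1 None) //=; congr (_ + _).
rewrite (reindex_omap Some id) //=; first by apply: eq_bigl => a; rewrite eqxx.
by case.
Qed.

Lemma le_sum1 (A : finType) (q : A -> R) a : (forall a, 0 <= q a) -> q a <= \sum_a q a.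
Proof. by move=> q0; rewrite (bigD1 a) //= lerDl sumr_ge0. Qed.

(** Applied also to weights of total mass other than 1, such as the slices of a joint law. *)
Definition Ent (T : finType) (q : T -> R) : R := - \sum_t q t * log2 (q t).

Lemma eq_Ent (T : finType) (p q : T -> R) : p =1 q -> Ent p = Ent q.
Proof. by move=> E; congr (- _); apply: eq_bigr => t _; rewrite E. Qed.

Lemma Ent_pair (A B : finType) (q : A * B -> R) :
  Ent q = \sum_b Ent (fun a => q (a, b)).
Proof. by rewrite /Ent sum_pair exchange_big sumrN. Qed.

(** The defect of homogeneity depends only on the total mass, so it cancels in a difference of
    entropies of equal total mass. *)
Lemma Ent_scale (T : finType) (c : R) (q : T -> R) : 0 <= c -> (forall t, 0 <= q t) ->
  Ent (fun t => c * q t) = c * Ent q - c * log2 c * \sum_t q t.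
Proof.
move=> c0 q0; rewrite /Ent mulrN -opprD mulr_sumr mulr_sumr -big_split; congr (- _).
apply: eq_bigr => t _ /=.
have [->|cn0] := eqVneq c 0; first by rewrite !mul0r addr0.
have [->|qn0] := eqVneq (q t) 0; first by rewrite !(mulr0, mul0r) addr0.
by rewrite log2M ?lt_neqAle ?c0 ?q0 ?(eq_sym 0) ?cn0 ?qn0 //; ring.
Qed.

Lemma marg1_ge0 (A B : finType) (p : {ffun A * B -> R}) :
  (forall t, 0 <= p t) -> forall a, 0 <= marg1 p a.
Proof. by move=> p0 a; rewrite ffunE sumr_ge0. Qed.

Lemma marg2_ge0 (A B : finType) (p : {ffun A * B -> R}) :
  (forall t, 0 <= p t) -> forall b, 0 <= marg2 p b.
Proof. by move=> p0 a; rewrite ffunE sumr_ge0. Qed.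

Lemma le_marg1 (A B : finType) (p : {ffun A * B -> R}) a b :
  (forall t, 0 <= p t) -> p (a, b) <= marg1 p a.
Proof. by move=> p0; rewrite ffunE; apply: (@le_sum1 _ (fun b => p (a, b))). Qed.

Lemma le_marg2 (A B : finType) (p : {ffun A * B -> R}) a b :
  (forall t, 0 <= p t) -> p (a, b) <= marg2 p b.
Proof. by move=> p0; rewrite ffunE; apply: (@le_sum1 _ (fun a => p (a, b))). Qed.

Lemma condentE (A B : finType) (p : {ffun A * B -> R}) : (forall t, 0 <= p t) ->
  condent p = Ent p - Ent (marg2 p).
Proof.
move=> p0; rewrite /condent /Ent opprK -[X in - X + _]opprK opprK addrC.
have -> : \sum_t marg2 p t * log2 (marg2 p t) = \sum_t p t * log2 (marg2 p t.2).
  rewrite sum_pair exchange_big /=; apply: eq_bigr => b _.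
  by rewrite -mulr_suml; congr (_ * _); rewrite ffunE.
rewrite -sumrB -sumrN; apply: eq_bigr => -[a b] _ /=.
case: ltP => [pp|pn].
  rewrite log2_div //; first by ring.
  exact: lt_le_trans pp (le_marg2 _ _ p0).
have -> : p (a, b) = 0 by apply/le_anti; rewrite pn p0.
by rewrite !mul0r subrr oppr0.
Qed.

Lemma condent_ge0 (A B : finType) (p : {ffun A * B -> R}) : (forall t, 0 <= p t) ->
  0 <= condent p.
Proof.
move=> p0; rewrite /condent -sumrN; apply: sumr_ge0 => -[a b] _ /=.
case: ltP => [pp|_]; last by rewrite oppr0.
have mp := lt_le_trans pp (le_marg2 a b p0).
rewrite -mulrN mulr_ge0 // oppr_ge0 /log2 pmulr_lle0 ?invr_gt0 ?ln2_gt0 //.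
by rewrite ln_le0 // ler_pdivrMr // mul1r le_marg2.
Qed.

Lemma mutinfoE (A B : finType) (p : {ffun A * B -> R}) : (forall t, 0 <= p t) ->
  mutinfo p = Ent (marg1 p) + Ent (marg2 p) - Ent p.
Proof.
move=> p0; rewrite /mutinfo /Ent opprK.
have -> : \sum_t marg2 p t * log2 (marg2 p t) = \sum_t p t * log2 (marg2 p t.2).
  rewrite sum_pair exchange_big /=; apply: eq_bigr => b _.
  by rewrite -mulr_suml; congr (_ * _); rewrite ffunE.
have -> : \sum_t marg1 p t * log2 (marg1 p t) = \sum_t p t * log2 (marg1 p t.1).
  rewrite sum_pair /=; apply: eq_bigr => b _.
  by rewrite -mulr_suml; congr (_ * _); rewrite ffunE.
rewrite -!sumrN -!big_split; apply: eq_bigr => -[a b] _ /=.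
case: ltP => [pp|pn].
  have h1 := lt_le_trans pp (le_marg1 a b p0).
  have h2 := lt_le_trans pp (le_marg2 a b p0).
  by rewrite log2_div ?mulr_gt0 // log2M //; ring.
have -> : p (a, b) = 0 by apply/le_anti; rewrite pn p0.
by rewrite !mul0r !oppr0 !addr0.
Qed.

(* [P'] is the law obtained when the option component of the auxiliary variable reveals the
   [V]-component with probability [l]. *)
Lemma reveal_auxiliary (X V U : finType) (P : {ffun X * (V * U) -> R}) l :
  is_pmf P -> 0 <= l <= 1 ->
  exists P' : {ffun X * (V * (U * option V)) -> R},
    [/\ is_pmf P', marg1 P' = marg1 P, mutinfo P' = mutinfo P,
        condent (marg2 P') = (1 - l) * condent (marg2 P) &
        forall F : X -> V -> U -> R,
          \sum_t P' t * F t.1 t.2.1 t.2.2.1 = \sum_t P t * F t.1 t.2.1 t.2.2].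
Proof.
move=> [P0 P1] /andP[l0 l1].
have l1' : 0 <= 1 - l by rewrite subr_ge0.
(* [w o v] is the probability of the new component [o] given [v]: [None] hides [v], and [Some] tells
   it correctly. *)
pose w (o : option V) (v : V) : R := if o is Some v' then l * (v == v')%:R else 1 - l.
have w0 o v : 0 <= w o v by case: o => //= v'; rewrite mulr_ge0.
have wsum v : \sum_o w o v = 1.
  rewrite sum_option /= (bigD1 v) //= eqxx mulr1 big1 ?addr0 ?subrK // => v' /negbTE vv.
  by rewrite eq_sym vv mulr0.
pose P' : {ffun X * (V * (U * option V)) -> R} :=
  [ffun t => w t.2.2.2 t.2.1 * P (t.1, (t.2.1, t.2.2.1))].
have P'0 t : 0 <= P' t by rewrite ffunE mulr_ge0.
have P'F F : \sum_t P' t * F t.1 t.2.1 t.2.2.1 = \sum_t P t * F t.1 t.2.1 t.2.2.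
  rewrite !sum_pair; apply: eq_bigr => x _; rewrite !sum_pair; apply: eq_bigr => v _.
  rewrite !sum_pair; apply: eq_bigr => u _ /=.
  rewrite -[RHS]mul1r -(wsum v) mulr_suml; apply: eq_bigr => o _.
  by rewrite ffunE /= mulrA.
have m1 : marg1 P' = marg1 P.
  apply/ffunP => x; rewrite !ffunE !sum_pair; apply: eq_bigr => v _.
  rewrite !sum_pair; apply: eq_bigr => u _ /=.
  rewrite -[RHS]mul1r -(wsum v) mulr_suml; apply: eq_bigr => o _.
  by rewrite ffunE.
have m2 v u o : marg2 P' (v, (u, o)) = w o v * marg2 P (v, u).
  by rewrite !ffunE mulr_sumr; apply: eq_bigr => x _; rewrite ffunE.
have m3 u : marg2 (marg2 P') (u, None) = (1 - l) * marg2 (marg2 P) u.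
  by rewrite !ffunE mulr_sumr; apply: eq_bigr => v _; rewrite m2.
have m3' u v : marg2 (marg2 P') (u, Some v) = l * marg2 P (v, u).
  rewrite ffunE (bigD1 v) //= m2 /= eqxx mulr1 big1 ?addr0 // => v' /negbTE vv.
  by rewrite m2 /= vv mulr0 mul0r.
have mP0 : forall t, 0 <= marg2 P t by exact: marg2_ge0.
have mP1 : \sum_t marg2 P t = 1.
  by rewrite -P1 [RHS]sum_pair exchange_big /=; apply: eq_bigr => t _; rewrite ffunE.
have mmP0 : forall t, 0 <= marg2 (marg2 P) t by exact: marg2_ge0.
have mmP1 : \sum_t marg2 (marg2 P) t = 1.
  by rewrite -mP1 [RHS]sum_pair exchange_big /=; apply: eq_bigr => t _; rewrite ffunE.
have E1 : Ent P' = Ent (fun t => (1 - l) * P t) + Ent (fun t => l * P t).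
  rewrite /Ent -opprD -big_split; congr (- _).
  rewrite !sum_pair; apply: eq_bigr => x _; rewrite !sum_pair; apply: eq_bigr => v _.
  rewrite !sum_pair; apply: eq_bigr => u _ /=.
  rewrite sum_option !ffunE /=; congr (_ + _).
  rewrite (bigD1 v) //= ffunE /= eqxx mulr1 big1 ?addr0 // => v' /negbTE vv.
  by rewrite ffunE /= eq_sym vv mulr0 !mul0r.
have E2 : Ent (marg2 P') = Ent (fun t => (1 - l) * marg2 P t) + Ent (fun t => l * marg2 P t).
  rewrite /Ent -opprD -big_split; congr (- _).
  rewrite !sum_pair; apply: eq_bigr => v _.
  rewrite !sum_pair; apply: eq_bigr => u _ /=.
  rewrite sum_option !m2 /=; congr (_ + _).
  rewrite (bigD1 v) //= m2 /= eqxx mulr1 big1 ?addr0 // => v' /negbTE vv.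
  by rewrite m2 /= eq_sym vv mulr0 !mul0r.
(* Where [v] is revealed, the auxiliary variable has the weights of the pair (v,u) itself. The
   second term is thus the same as in [E2], and that part adds nothing to the conditional
   entropy. *)
have E3 : Ent (marg2 (marg2 P')) =
    Ent (fun t => (1 - l) * marg2 (marg2 P) t) + Ent (fun t => l * marg2 P t).
  rewrite /Ent -opprD; congr (- _).
  rewrite sum_pair [X in _ = _ + X]sum_pair [X in _ = _ + X]exchange_big -big_split /=.
  apply: eq_bigr => u _; rewrite sum_option m3; congr (_ + _).
  by apply: eq_bigr => v _; rewrite m3'.
exists P'; split => //.
- split=> //; have := P'F (fun _ _ _ => 1).
  by rewrite (eq_bigr _ (fun t _ => mulr1 _)) => ->; rewrite (eq_bigr _ (fun t _ => mulr1 _)).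
- by rewrite !mutinfoE // m1 E1 E2 !Ent_scale // P1 mP1; ring.
- rewrite !condentE //; last exact: marg2_ge0.
  by rewrite E2 E3 !Ent_scale // mmP1 mP1; ring.
Qed.

Lemma condent_expect (X V U : finType) (P : {ffun X * (V * U) -> R}) :
  (forall t, 0 <= P t) ->
  condent (marg2 P) =
  \sum_t P t * - log2 (marg2 P t.2 / marg2 (marg2 P) t.2.2).
Proof.
move=> P0; rewrite /condent -sumrN [RHS]sum_pair exchange_big /=; apply: eq_bigr => -[v u] _ /=.
rewrite -mulr_suml; have <- : marg2 P (v, u) = \sum_i P (i, (v, u)) by rewrite ffunE.
rewrite mulrN; case: ltP => // m0; congr (- _).
have -> : marg2 P (v, u) = 0 by apply/le_anti; rewrite m0 marg2_ge0.
by rewrite mul0r.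
Qed.

(** A pointwise identity of logarithms on the support of [P]. The right-hand side is I(X;U) -
    H(V|X,U), written through the averages that typicality controls. *)
Lemma mutinfo_sub_condent (X V U : finType) (P : {ffun X * (V * U) -> R}) :
  (forall t, 0 <= P t) ->
  let pxu x u := \sum_v P (x, (v, u)) in
  mutinfo P - condent (marg2 P) =
  \sum_t P t * log2 (pxu t.1 t.2.2 / (marg1 P t.1 * marg2 (marg2 P) t.2.2)) -
  \sum_t P t * - log2 (P t / pxu t.1 t.2.2).
Proof.
move=> P0 pxu; rewrite condent_expect // /mutinfo -!sumrB; apply: eq_bigr => -[x [v u]] _ /=.
case: ltP => [pp|pn].
  have h1 := lt_le_trans pp (le_marg1 _ _ P0).
  have h2 := lt_le_trans pp (le_marg2 _ _ P0).
  have h3 := lt_le_trans h2 (le_marg2 v u (marg2_ge0 P0)).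
  have h4 : 0 < pxu x u.
    by apply: lt_le_trans pp _; apply: (@le_sum1 _ (fun v => P (x, (v, u)))).
  by rewrite !log2_div ?mulr_gt0 // !log2M //; ring.
have -> : P (x, (v, u)) = 0 by apply/le_anti; rewrite pn P0.
by rewrite !mul0r.
Qed.

End Entropy.

(** * Typical blocks and achievability *)

Section TypicalBlocks.
Variable R : realType.

(** One Chebyshev bound for each statistic. A block with a letter of mass zero has weight zero, so
    the positivity requirement costs nothing. *)
Lemma prod_typical (Z : finType) (m N : nat) (p : Z -> R) (phi : 'I_m -> Z -> R) (eta : R) :
  (forall z, 0 <= p z) -> \sum_z p z = 1 -> 0 < eta -> (0 < N)%N ->
  \sum_(z : {ffun 'I_N -> Z} | ~~ ([forall i, 0 < p (z i)] &&
      [forall k, `|\sum_i phi k (z i) - N%:R * \sum_t p t * phi k t| <= eta * N%:R]))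
    \prod_i p (z i)
  <= (\sum_k \sum_t p t * (phi k t - \sum_t p t * phi k t) ^+ 2) / (N%:R * eta ^+ 2).
Proof.
move=> p0 p1 eta0 N0; rewrite mulr_suml.
pose dev k (z : {ffun 'I_N -> Z}) :=
  eta * #|'I_N|%:R < `|\sum_i phi k (z i) - #|'I_N|%:R * \sum_t p t * phi k t|.
apply: (@le_trans _ _ (\sum_k \sum_(z : {ffun 'I_N -> Z} | dev k z) \prod_i p (z i))).
  rewrite [leRHS](eq_bigr _ (fun k _ => big_mkcond _ _)) [leRHS]exchange_big /= big_mkcond.
  apply: ler_sum => z _.
  have pz0 : 0 <= \prod_i p (z i) by apply: prodr_ge0.
  have s0 (P : pred 'I_m) : 0 <= \sum_(k | P k) (if dev k z then \prod_i p (z i) else 0).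
    by apply: sumr_ge0 => k _; case: ifP.
  case: ifP => [|_]; last exact: s0.
  rewrite negb_and !negb_forall => /orP[/existsP[i]|/existsP[k]].
    rewrite -leNgt => pi0; have pz : p (z i) = 0 by apply/le_anti; rewrite pi0 p0.
    by rewrite [leLHS](bigD1 i) //= pz mul0r s0.
  rewrite -ltNge => dk; have {}dk : dev k z by rewrite /dev card_ord.
  rewrite [leRHS](bigD1 k) //= dk lerDl.
  exact: s0.
apply: ler_sum => k _.
have := prod_weight_chebyshev (I := 'I_N) (phi k) p0 p1 eta0.
by rewrite /dev !card_ord => /(_ N0).
Qed.

Lemma powR2D (x y : R) : 2 `^ (x + y) = 2 `^ x * 2 `^ y.
Proof. by rewrite powRD // pnatr_eq0 implybT. Qed.

Lemma powR2_gt0 (x : R) : 0 < 2 `^ x :> R.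
Proof. by rewrite powR_gt0. Qed.

Lemma le_powR2 (x y : R) : x <= y -> 2 `^ x <= 2 `^ y :> R.
Proof. by move=> xy; rewrite ler_powR // ler1n. Qed.

Lemma powR2X (x : R) n : (2 `^ x) ^+ n = 2 `^ (n%:R * x) :> R.
Proof. by rewrite mulrC powRrM powR_mulrn // ltW // powR2_gt0. Qed.

Lemma powR2_log2 (x : R) : 0 < x -> 2 `^ log2 x = x.
Proof.
move=> x0; rewrite /powR pnatr_eq0 /= /log2 divfK ?lnK ?posrE //.
by rewrite gt_eqF // ln2_gt0.
Qed.

Lemma powR2_sum (I : finType) (g : I -> R) : 2 `^ (\sum_i g i) = \prod_i 2 `^ g i :> R.
Proof.
by elim/big_rec2: _ => [|i y1 y2 _ <-]; rewrite ?powRr0 // powR2D.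
Qed.

(** Converts an empirical average of log-ratios into a comparison of block probabilities. *)
Lemma prod_log2_ratio (I : finType) (a b : I -> R) :
  (forall i, 0 < a i) -> (forall i, 0 < b i) ->
  \prod_i a i = (\prod_i b i) * 2 `^ (\sum_i log2 (a i / b i)).
Proof.
move=> a0 b0; rewrite powR2_sum -big_split; apply: eq_bigr => i _ /=.
by rewrite powR2_log2 ?divr_gt0 // mulrC divfK // gt_eqF.
Qed.

Variables (X V X2 U : finType) (P : {ffun X * (V * U) -> R}) (f : U -> V -> X2).
Variables (d1 : X -> V -> R) (d2 : X -> X2 -> R).
Hypothesis Ppmf : is_pmf P.

Let pxu x u := \sum_v P (x, (v, u)).
Let pu := marg2 (marg2 P).
(** The five statistics of typicality: the information density of (x,u), the surprisal of v given
    (x,u), the surprisal of v given u, and the two distortions. *)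
Let phi (k : 'I_5) (t : X * (V * U)) : R :=
  match val k with
  | 0 => log2 (pxu t.1 t.2.2 / (marg1 P t.1 * pu t.2.2))
  | 1 => - log2 (P t / pxu t.1 t.2.2)
  | 2 => - log2 (marg2 P t.2 / pu t.2.2)
  | 3 => d1 t.1 t.2.1
  | _ => d2 t.1 (f t.2.2 t.2.1)
  end.
Let mean k := \sum_t P t * phi k t.
Let Ixu := mean (@Ordinal 5 0 isT).
Let Hvxu := mean (@Ordinal 5 1 isT).
Let Hvu := mean (@Ordinal 5 2 isT).
Let D1 := mean (@Ordinal 5 3 isT).
Let D2 := mean (@Ordinal 5 4 isT).

(** The one-shot construction for blocks, with alpha = 2^(N(I(X;U) + eta)) and kappa = 2^(N(H(V|X,U)
    - eta)). The margins of 2 eta in [M] and [K] make both failure exponents at least 2^(N eta)/2.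
    [C] is the sum of the variances of the five statistics, and the factor 4 comes from the one-shot
    bound. *)
Lemma block_code_exists (eta : R) : 0 < eta ->
  exists2 C : R, 0 <= C & forall N M K : nat,
  let bound := 4 * (C / (N%:R * eta ^+ 2)) in
  (0 < N)%N -> (0 < K)%N -> bound < 1 ->
  2 `^ (N%:R * (Ixu + 2 * eta)) <= M%:R ->
  (K = 1%N \/ K%:R <= 2 `^ (N%:R * (Hvxu - 2 * eta))) ->
  (#|X|%:R * #|U|%:R * (1 + 2 `^ Hvxu)) ^+ N * expR (- (2 `^ (N%:R * eta) / 2)) < 1 ->
  exists (code : 'I_M -> {ffun 'I_N -> U}) (col : {ffun 'I_N -> V} -> 'I_K)
         (mu : {ffun 'I_N -> X} -> 'I_M)
         (nu : {ffun 'I_N -> X} -> 'I_K -> {ffun 'I_N -> V})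
         (Q : {ffun 'I_N -> U} -> {set {ffun 'I_N -> V}})
         (G : pred {ffun 'I_N -> X}),
    (forall u, #|Q u|%:R <= 2 `^ (N%:R * (Hvu + eta))) /\
    (forall y k, col (nu y k) = k) /\ (forall y k, nu y k \in Q (code (mu y))) /\
    (forall y k, G y -> \sum_i d1 (y i) (nu y k i) <= N%:R * (D1 + eta)) /\
    (forall y k, G y ->
       \sum_i d2 (y i) (f (code (mu y) i) (nu y k i)) <= N%:R * (D2 + eta)) /\
    \sum_(y : {ffun 'I_N -> X} | ~~ G y) \prod_i marg1 P (y i) <= bound.
Proof.
move=> eta0; have [P0 P1] := Ppmf.
pose C := \sum_k \sum_t P t * (phi k t - mean k) ^+ 2.
exists C; first by apply: sumr_ge0 => k _; apply: sumr_ge0 => t _; rewrite mulr_ge0 ?sqr_ge0.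
move=> N M K bound N0 K0 b1 Mge Kle cN.
have N0r : 0 < N%:R :> R by rewrite ltr0n.
pose z3 (x : {ffun 'I_N -> X}) (v : {ffun 'I_N -> V}) (u : {ffun 'I_N -> U})
  : {ffun 'I_N -> X * (V * U)} := [ffun i => (x i, (v i, u i))].
pose typ (z : {ffun 'I_N -> X * (V * U)}) := [forall i, 0 < P (z i)] &&
  [forall k, `|\sum_i phi k (z i) - N%:R * mean k| <= eta * N%:R].
pose T x v u := typ (z3 x v u).
pose W x v u : R := \prod_i P (z3 x v u i).
have W0 x v u : 0 <= W x v u by apply: prodr_ge0.
have WxuE x u : \sum_v W x v u = \prod_i pxu (x i) (u i).
  rewrite -(sum_prod_indep (fun i v => P (x i, (v, u i)))).
  by apply: eq_bigr => v _; apply: eq_bigr => i _; rewrite ffunE.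
have WxE x : \sum_u \sum_v W x v u = \prod_i marg1 P (x i).
  rewrite (eq_bigr _ (fun u _ => WxuE x u)).
  rewrite (sum_prod_indep (fun i u => pxu (x i) u)); apply: eq_bigr => i _.
  by rewrite /pxu ffunE sum_pair exchange_big.
have puE u : pu u = \sum_x pxu x u.
  rewrite /pu ffunE exchange_big /=; apply: eq_bigr => v _; rewrite ffunE.
  by apply: eq_bigr.
have WuE u : \sum_x \sum_v W x v u = \prod_i pu (u i).
  rewrite (eq_bigr _ (fun x _ => WxuE x u)).
  rewrite (sum_prod_indep (fun i x => pxu x (u i))); apply: eq_bigr => i _.
  by rewrite puE.
have WvuE v u : \sum_x W x v u = \prod_i marg2 P (v i, u i).
  transitivity (\prod_i \sum_x P (x, (v i, u i))); last first.
    by apply: eq_bigr => i _; rewrite ffunE.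
  rewrite -(sum_prod_indep (fun i x => P (x, (v i, u i)))).
  by apply: eq_bigr => x _; apply: eq_bigr => i _; rewrite ffunE.
have W1 : \sum_x \sum_u \sum_v W x v u = 1.
  rewrite (eq_bigr _ (fun x _ => WxE x)).
  rewrite (sum_prod_indep (fun i x => marg1 P x)) big1 // => i _.
  by rewrite -P1 sum_pair; apply: eq_bigr => x _; rewrite ffunE.
have Tpos x v u : T x v u -> forall i, [/\ 0 < P (x i, (v i, u i)), 0 < pxu (x i) (u i),
    0 < marg1 P (x i), 0 < pu (u i) & 0 < marg2 P (v i, u i)].
  move=> /andP[/forallP h _] i; have := h i; rewrite ffunE => pp; split => //.
  - by apply: lt_le_trans pp _; apply: (@le_sum1 _ _ (fun v => P (x i, (v, u i)))).
  - exact: lt_le_trans pp (le_marg1 _ _ P0).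
  - apply: lt_le_trans pp _; apply: (le_trans (le_marg2 (x i) (v i, u i) P0)).
    exact: le_marg2 (marg2_ge0 P0).
  - exact: lt_le_trans pp (le_marg2 _ _ P0).
have Tdev x v u k : T x v u ->
    N%:R * (mean k - eta) <= \sum_i phi k (x i, (v i, u i)) <= N%:R * (mean k + eta).
  move=> /andP[_ /forallP/(_ k)].
  rewrite (eq_bigr (fun i => phi k (x i, (v i, u i)))); last by move=> i _; rewrite ffunE.
  by rewrite ler_norml => /andP[h1 h2]; apply/andP; split; lra.
pose alpha : R := 2 `^ (N%:R * (Ixu + eta)).
pose kappa : R := 2 `^ (N%:R * (Hvxu - eta)).
have a0 : 0 < alpha by exact: powR2_gt0.
have k0 : 0 < kappa by exact: powR2_gt0.
have Ta x v u : T x v u ->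
    \sum_v W x v u <= (\sum_u \sum_v W x v u) * (\sum_x \sum_v W x v u) * alpha.
  move=> Txvu; rewrite WxuE WxE WuE -big_split /=.
  rewrite (@prod_log2_ratio _ (fun i => pxu (x i) (u i)) (fun i => marg1 P (x i) * pu (u i))); first last.
  - by move=> i; have [_ _ h1 h2 _] := Tpos _ _ _ Txvu i; exact: mulr_gt0.
  - by move=> i; have [_ h1 _ _ _] := Tpos _ _ _ Txvu i.
  rewrite ler_wpM2l //.
    by apply: prodr_ge0 => i _; have [_ _ h1 h2 _] := Tpos _ _ _ Txvu i; rewrite ltW ?mulr_gt0.
  apply: le_powR2; have /andP[_] := Tdev _ _ _ (@Ordinal 5 0 isT) Txvu.
  by [].
have Tk x v u : T x v u -> W x v u * kappa <= \sum_v W x v u.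
  move=> Txvu; rewrite WxuE /W (eq_bigr (fun i => P (x i, (v i, u i)))); last first.
    by move=> i _; rewrite ffunE.
  rewrite (@prod_log2_ratio _ (fun i => P (x i, (v i, u i))) (fun i => pxu (x i) (u i))); first last.
  - by move=> i; have [_ h1 _ _ _] := Tpos _ _ _ Txvu i.
  - by move=> i; have [] := Tpos _ _ _ Txvu i.
  rewrite -mulrA -powR2D -[leRHS]mulr1 ler_wpM2l //.
    by apply: prodr_ge0 => i _; have [_ h1 _ _ _] := Tpos _ _ _ Txvu i; rewrite ltW.
  rewrite -[leRHS](powRr0 2); apply: le_powR2.
  have /andP[+ _] := Tdev _ _ _ (@Ordinal 5 1 isT) Txvu.
  rewrite /phi /=.
  by rewrite sumrN -/Hvxu; lra.
(* Given u, every block v typical with u and some x has probability at least 2^(-N(H(V|U) + eta)).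
   This bounds the number of such v, hence the range of the private rank. *)
have Tl x v u : T x v u -> \prod_i pu (u i) <=
    (\sum_x W x v u) * 2 `^ (N%:R * (Hvu + eta)).
  move=> Txvu; rewrite WvuE.
  rewrite (@prod_log2_ratio _ (fun i => marg2 P (v i, u i)) (fun i => pu (u i))); first last.
  - by move=> i; have [_ _ _ h1 _] := Tpos _ _ _ Txvu i.
  - by move=> i; have [] := Tpos _ _ _ Txvu i.
  rewrite -mulrA -powR2D -[leLHS]mulr1 ler_wpM2l //.
    by apply: prodr_ge0 => i _; have [_ _ _ h1 _] := Tpos _ _ _ Txvu i; rewrite ltW.
  rewrite -[leLHS](powRr0 2); apply: le_powR2.
  have /andP[_] := Tdev _ _ _ (@Ordinal 5 2 isT) Txvu.
  rewrite /phi /=.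
  by rewrite sumrN -/Hvu; lra.
have Weps : \sum_x \sum_u \sum_(v | ~~ T x v u) W x v u <= C / (N%:R * eta ^+ 2).
  have := prod_typical phi P0 P1 eta0 N0; apply: le_trans.
  rewrite [leRHS](_ : _ = \sum_(z | ~~ typ z) \prod_i P (z i)) //.
  rewrite [leRHS](reindex (fun p : {ffun 'I_N -> X} * ({ffun 'I_N -> U} * {ffun 'I_N -> V}) =>
     z3 p.1 p.2.2 p.2.1)) /=; last first.
    exists (fun z => ([ffun i => (z i).1], ([ffun i => (z i).2.2], [ffun i => (z i).2.1])))
      => [[x [u v]] _|z _] /=.
      by congr (_, (_, _)); apply/ffunP => i; rewrite !ffunE.
    by apply/ffunP => i; rewrite !ffunE /=; case: (z i) => a [].
  rewrite [leRHS]big_mkcond sum_pair; apply: ler_sum => x _.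
  rewrite sum_pair; apply: ler_sum => u _ /=.
  by rewrite big_mkcond.
have cU : 1 <= #|U|%:R :> R.
  rewrite ler1n; case: (posnP #|U|) => // U0.
  suff : \sum_t P t = 0 by rewrite P1 => /eqP; rewrite oner_eq0.
  by apply: big1 => -[x [v u]]; have := fintype0 u U0.
(* The summand 1 makes the common base dominate in both union bounds: that over x alone, and that
   over (x, u, colour), where [K] is at most 2^(N H(V|X,U)). *)
have cH : 1 <= 1 + 2 `^ Hvxu :> R by rewrite lerDl ltW ?powR2_gt0.
have cX : #|X|%:R ^+ N <= (#|X|%:R * #|U|%:R * (1 + 2 `^ Hvxu)) ^+ N :> R.
  by rewrite lerXn2r ?nnegrE ?mulr_ge0 // ?(le_trans ler01) // -mulrA ler_peMr // mulr_ege1.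
have [||code [col [G [HG HT]]]] := one_shot_code (M := M) (K := K) W0 W1 Weps a0 k0 K0 Ta Tk.
- apply: le_lt_trans cN; rewrite card_ffun card_ord natrX.
  apply: ler_pM => //; rewrite ?exprn_ge0 ?expR_ge0 // ler_expR lerN2.
  rewrite ler_pdivlMr ?mulr_gt0 //; apply: le_trans Mge.
  suff <- : 2 `^ (N%:R * eta) * alpha = 2 `^ (N%:R * (Ixu + 2 * eta)) by lra.
  by rewrite -powR2D; congr (2 `^ _); ring.
- case: Kle => [->|Kle]; [by left|right].
  have Kr : 0 < K%:R :> R by rewrite ltr0n.
  apply: le_lt_trans cN; rewrite !card_ffun card_ord !natrX.
  apply: ler_pM => //; rewrite ?mulr_ge0 ?exprn_ge0 ?expR_ge0 //.
    rewrite !exprMn ler_wpM2l ?mulr_ge0 ?exprn_ge0 //.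
    apply: (le_trans Kle); apply: (@le_trans _ _ ((2 `^ Hvxu) ^+ N)).
      by rewrite powR2X; apply: le_powR2; rewrite ler_pM2l //; lra.
    by rewrite lerXn2r ?nnegrE ?(ltW (powR2_gt0 _)) ?(le_trans ler01 cH) // lerDr.
  rewrite ler_expR lerN2 ler_pdivlMr ?mulr_gt0 //.
  suff : 2 `^ (N%:R * eta) * K%:R <= kappa by lra.
  apply: (le_trans (ler_wpM2l (ltW (powR2_gt0 _)) Kle)).
  by rewrite -powR2D; apply: le_powR2; lra.
have HG' : \sum_(y : {ffun 'I_N -> X} | ~~ G y) \prod_i marg1 P (y i) <= bound.
  by rewrite (eq_bigr _ (fun x _ => esym (WxE x))).
(* [bound < 1] leaves at least one good block, which stands in for all bad ones. *)
have [x0 Gx0] : exists x0, G x0.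
  apply/existsP; rewrite -[X in is_true X]negbK negb_exists; apply/negP => /forallP nG.
  have := le_lt_trans HG b1; rewrite (eq_bigl predT) => [|x]; last by rewrite nG.
  by rewrite W1 ltxx.
pose rep y := if G y then y else x0.
have Grep y : G (rep y) by rewrite /rep; case: ifP.
have /boolp.choice[mu /boolp.choice[nu munu]] : forall y, exists m, exists nuy : 'I_K -> {ffun 'I_N -> V},
    forall k, T (rep y) (nuy k) (code m) /\ col (nuy k) = k.
  move=> y; have [m Hm] := HT _ (Grep y); exists m.
  have /boolp.choice[nuy Hnu] : forall k, exists v, T (rep y) v (code m) /\ col v = k.
    by move=> k; have [v] := Hm k; exists v.
  by exists nuy.
pose Q (u : {ffun 'I_N -> U}) := [set v | [exists x, T x v u]].
exists code, col, mu, nu, Q, G.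
have Grep_id y : G y -> rep y = y by rewrite /rep => ->.
do 5?[split].
- move=> u; case: (pickP [pred v | [exists x, T x v u]]) => [v1 /existsP[x1 Tx1]|Q0]; last first.
    rewrite (eq_card0 (A := Q u)) ?(ltW (powR2_gt0 _)) //.
    by move=> v; rewrite !inE; exact: Q0.
  have pu0 : 0 < \prod_i pu (u i) by apply: prodr_gt0 => i _; have [] := Tpos _ _ _ Tx1 i.
  rewrite -(ler_pM2r pu0) [leLHS]mulr_natl -sumr_const [leRHS]mulrC.
  apply: (@le_trans _ _ (\sum_(v in Q u)
      (\sum_x W x v u) * 2 `^ (N%:R * (Hvu + eta)))).
    by apply: ler_sum => v; rewrite inE => /existsP[x]; exact: Tl.
  rewrite -mulr_suml ler_wpM2r ?(ltW (powR2_gt0 _)) // -WuE exchange_big /=.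
  apply: ler_sum => x _; rewrite [leRHS](bigID [in Q u]) /=.
  by rewrite lerDl sumr_ge0.
- by move=> y k; have [] := munu y k.
- by move=> y k; rewrite inE; apply/existsP; exists (rep y); have [] := munu y k.
- move=> y k Gy; have [+ _] := munu y k; rewrite Grep_id // => /(Tdev _ _ _ (@Ordinal 5 3 isT))/andP[_].
  by [].
- move=> y k Gy; have [+ _] := munu y k; rewrite Grep_id // => /(Tdev _ _ _ (@Ordinal 5 4 isT))/andP[_].
  by [].
- exact: HG'.
Qed.

End TypicalBlocks.

(** * Choice of the parameters and rates at the corner point *)

Section Corner.
Variable R : realType.

(** With a = eta ln 2, c^N is at most exp(cN), while 2^(N eta) = exp(Na) is at least (1 + Na/2)^2;
    so 8cN < (Na)^2 is enough. The bound by 4 later absorbs a constant factor in the number of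
    quotients. *)
Lemma exists_block_length (C c eta eps : R) : 0 <= C -> 0 <= c -> 0 < eta -> 0 < eps ->
  exists N : nat, [/\ (0 < N)%N, 4 * (C / (N%:R * eta ^+ 2)) < eps,
    c ^+ N * expR (- (2 `^ (N%:R * eta) / 2)) < 1 & 4 <= 2 `^ (N%:R * eta)].
Proof.
move=> C0 c0 eta0 eps0.
pose a := eta * ln 2 : R.
have a0 : 0 < a by rewrite mulr_gt0 ?ln2_gt0.
(* Lower bounds on N for, respectively, the product with c^N, the inequality 1 + Na > 4, and the
   Chebyshev term. *)
pose t1 := 8 * c / a ^+ 2; pose t2 := 3 / a; pose t3 := 4 * C / (eta ^+ 2 * eps).
have t10 : 0 <= t1 by apply: divr_ge0; [exact: mulr_ge0|exact: (exprn_ge0 _ (ltW a0))].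
have t20 : 0 <= t2 by exact: (divr_ge0 _ (ltW a0)).
have t30 : 0 <= t3.
  by apply: divr_ge0; [exact: mulr_ge0|rewrite mulr_ge0 ?(ltW eps0) ?(exprn_ge0 _ (ltW eta0))].
pose N := (Num.trunc (t1 + t2 + t3)).+1.
have tN : t1 + t2 + t3 < N%:R.
  by have /andP[] := truncn_itv (addr_ge0 (addr_ge0 t10 t20) t30).
have Npos : (0 < N)%N by [].
have N0 : 0 < N%:R :> R by rewrite ltr0n.
clearbody N.
have h1 : 8 * c < N%:R * a ^+ 2 by rewrite -ltr_pdivrMr ?exprn_gt0 //; rewrite -/t1; lra.
have h2 : 3 < N%:R * a by rewrite -ltr_pdivrMr // -/t2; lra.
have h3 : 4 * C < N%:R * (eta ^+ 2 * eps).
  by rewrite -ltr_pdivrMr ?mulr_gt0 ?exprn_gt0 //; rewrite -/t3; lra.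
have pE : 2 `^ (N%:R * eta) = expR (N%:R * a) by rewrite /powR pnatr_eq0 /= /a mulrA.
have p1 := expR_ge1Dx (N%:R * a).
have p2 : (1 + N%:R * a / 2) ^+ 2 <= expR (N%:R * a).
  rewrite -[X in expR X](divfK (_ : 2 != 0 :> R)) ?pnatr_eq0 // expRM_natr.
  by rewrite lerXn2r ?nnegrE ?expR_ge0 ?expR_ge1Dx // addr_ge0 // divr_ge0 // mulr_ge0 // ltW.
exists N; split => //.
- rewrite mulrA ltr_pdivrMr ?mulr_gt0 ?exprn_gt0 //. lra.
- have cN : c ^+ N <= expR (c * N%:R).
    rewrite expRM_natr lerXn2r ?nnegrE ?expR_ge0 //.
    by have := expR_ge1Dx c; lra.
  apply: le_lt_trans (ler_wpM2r (expR_ge0 _) cN) _.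
  rewrite -expRD -[ltRHS]expR0 ltr_expR pE.
  have : 8 * c * N%:R < (N%:R * a) ^+ 2.
    by rewrite exprMn [N%:R ^+ 2]expr2 -[ltRHS]mulrA [ltLHS]mulrC ltr_pM2l.
  by lra.
- by rewrite pE; lra.
Qed.

Lemma achievable_corner (X X1 X2 U : finType) (P : {ffun X * (X1 * U) -> R})
    (f : U -> X1 -> X2) (d1 : X -> X1 -> R) (d2 : X -> X2 -> R) (D1 D2 r1 r2 : R) :
  is_pmf P -> (forall x a, 0 <= d1 x a) -> (forall x b, 0 <= d2 x b) ->
  \sum_t P t * d1 t.1 t.2.1 <= D1 -> \sum_t P t * d2 t.1 (f t.2.2 t.2.1) <= D2 ->
  mutinfo P - condent (marg2 P) <= r1 -> 0 <= r1 -> condent (marg2 P) <= r2 ->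
  forall delta, 0 < delta -> achievable (marg1 P) d1 d2 D1 D2 (r1 + delta, r2 + delta).
Proof.
move=> Ppmf d10 d20 hD1 hD2 hI r10 hH delta delta0 eps eps0.
have [P0 P1] := Ppmf.
have PX : is_pmf (marg1 P).
  split; first exact: marg1_ge0.
  by rewrite -P1 sum_pair; apply: eq_bigr => x _; rewrite ffunE.
(* The common rate loses 6 eta: 2 for the covering, 2 for the colours, 1 for constant factors, 1 for
   the first remainder. Each distortion loses 2 eta: typicality and bad blocks. *)
pose eta := Num.min (delta / 6) (eps / 2).
have eta0 : 0 < eta by rewrite /eta lt_min !divr_gt0.
have eta_delta : 6 * eta <= delta.
  have : eta <= delta / 6 by rewrite /eta ge_min lexx.
  by lra.
have eta_eps : 2 * eta <= eps.
  have : eta <= eps / 2 by rewrite /eta ge_min lexx orbT.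
  by lra.
have [C C0 blocks] := block_code_exists f d1 d2 Ppmf eta0.
move: blocks hI; rewrite mutinfo_sub_condent // /=.
set Ixu := \sum_t P t * log2 _; set Hvxu := \sum_t P t * - log2 _ => blocks hI.
have D1_ge0 : 0 <= D1.
  by apply: le_trans hD1; apply: sumr_ge0 => t _; rewrite mulr_ge0.
have D2_ge0 : 0 <= D2.
  by apply: le_trans hD2; apply: sumr_ge0 => t _; rewrite mulr_ge0.
pose dmax := \sum_x (\sum_a d1 x a + \sum_b d2 x b).
have dmax0 : 0 <= dmax by apply: sumr_ge0 => x _; rewrite addr_ge0 ?sumr_ge0.
have rowmax x : \sum_a d1 x a + \sum_b d2 x b <= dmax.
  by apply: (@le_sum1 _ _ (fun x => _)) => x'; rewrite addr_ge0 ?sumr_ge0.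
have dm1 x a : d1 x a <= dmax.
  apply: le_trans (rowmax x); apply: (le_trans (le_sum1 a (d10 x))).
  by rewrite lerDl sumr_ge0.
have dm2 x b : d2 x b <= dmax.
  apply: le_trans (rowmax x); apply: (le_trans (le_sum1 b (d20 x))).
  by rewrite lerDr sumr_ge0.
pose c := #|X|%:R * #|U|%:R * (1 + 2 `^ Hvxu) : R.
have c0 : 0 <= c by rewrite !mulr_ge0 // addr_ge0 // ltW // powR2_gt0.
(* The 1 guarantees a good block; the other term makes [dmax] times the bad probability at most
   [eta]. *)
pose eps' := Num.min 1 (eta / (1 + dmax)).
have dm10 : 0 < 1 + dmax by lra.
have eps'0 : 0 < eps' by rewrite /eps' lt_min ltr01 divr_gt0.
have [N [N0 Nb Nc N4]] := exists_block_length C0 c0 eta0 eps'0.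
have N0r : 0 < N%:R :> R by rewrite ltr0n.
(* So many blocks that the first remainder, about N H(V|X,U) bits, costs at most [eta] per
   letter. *)
pose B := (Num.trunc (`|Hvxu| / eta)).+1.
have hB : `|Hvxu| <= B%:R * eta.
  rewrite -ler_pdivrMr //; have /andP[_] := truncn_itv (divr_ge0 (normr_ge0 Hvxu) (ltW eta0)).
  exact: ltW.
have B0r : 0 < B%:R :> R by rewrite ltr0n.
pose M := (Num.trunc (2 `^ (N%:R * (Ixu + 2 * eta)))).+1.
have /andP[Mle Mge] := truncn_itv (ltW (powR2_gt0 (N%:R * (Ixu + 2 * eta)))).
pose kap := 2 `^ (N%:R * (Hvxu - 2 * eta)) : R.
have kap0 : 0 < kap by exact: powR2_gt0.
(* The integer part of [kap], or 1 if it vanishes; rounding loses at most a factor 2. *)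
have [K [K0 Kge Kle]] : exists K, [/\ (0 < K)%N, kap / 2 <= K%:R :> R & K = 1%N \/ K%:R <= kap].
  have /andP[tle tge] := truncn_itv (ltW kap0).
  case: (posnP (Num.trunc kap)) => [t0|tpos].
    by exists 1%N; split=> //; [rewrite t0 in tge; lra|left].
  exists (Num.trunc kap); split => //; last by right.
  have : 1 <= (Num.trunc kap)%:R :> R by rewrite ler1n.
  by move: tge; rewrite -natr1; lra.
have K0r : 0 < K%:R :> R by rewrite ltr0n.
have bound1 : 4 * (C / (N%:R * eta ^+ 2)) < 1.
  by apply: lt_le_trans Nb _; rewrite /eps' ge_min lexx.
have [code [col [mu [nu [Q [G [HQ [Hcol [HnuQ [HG1 [HG2 Hbad]]]]]]]]]]] :=
  blocks N M K N0 K0 bound1 (ltW Mge) Kle Nc.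
pose A := (M %/ K).+1.
pose L := Num.trunc (2 `^ (N%:R * (condent (marg2 P) + eta))).
have QL u : (#|Q u| <= L)%N.
  rewrite /L truncn_ge_nat ?(ltW (powR2_gt0 _)) //.
  by apply: le_trans (HQ u) _; rewrite condent_expect.
have MAK : (M <= A * K)%N by rewrite ltnW // ltn_ceil.
have bad_small : dmax * \sum_(y : {ffun 'I_N -> X} | ~~ G y) \prod_i marg1 P (y i) <= eta.
  have bad0 : 0 <= \sum_(y : {ffun 'I_N -> X} | ~~ G y) \prod_i marg1 P (y i).
    by apply: sumr_ge0 => y _; apply: prodr_ge0 => i _; exact: marg1_ge0.
  have : \sum_(y : {ffun 'I_N -> X} | ~~ G y) \prod_i marg1 P (y i) <= eta / (1 + dmax).
    by apply: (le_trans Hbad); apply: (le_trans (ltW Nb)); rewrite /eps' ge_min lexx orbT.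
  by rewrite ler_pdivlMr //; lra.
have [f0 [f1 [g1 [g2 [b1 b2]]]]] := block_markov_code (B := B) (f := f) (d1 := d1) (d2 := d2)
  (D1 := D1 + eta) (D2 := D2 + eta) PX (ltn0Sn _) N0 MAK QL Hcol HnuQ
  (addr_ge0 D1_ge0 (ltW eta0)) (addr_ge0 D2_ge0 (ltW eta0)) dmax0 dm1 dm2
  (fun y k Gy => le_trans (HG1 y k Gy) (ler_wpM2l (ltW N0r) (lerD hD1 (lexx eta))))
  (fun y k Gy => le_trans (HG2 y k Gy) (ler_wpM2l (ltW N0r) (lerD hD2 (lexx eta)))).
exists (B * N)%N; split; first by rewrite muln_gt0.
exists (A ^ B * K)%N, (L ^ B)%N; split; last split; last first.
- exists f0, f1, g1, g2; split; [apply: (le_trans b1)|apply: (le_trans b2)]; lra.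
- rewrite natrX; apply: (@le_trans _ _ ((2 `^ (N%:R * (condent (marg2 P) + eta))) ^+ B)).
    rewrite lerXn2r ?nnegrE ?(ltW (powR2_gt0 _)) //.
    by have /andP[] := truncn_itv (ltW (powR2_gt0 (N%:R * (condent (marg2 P) + eta)))).
  rewrite powR2X; apply: le_powR2; rewrite natrM mulrA ler_wpM2l ?mulr_ge0 //= .
  by lra.
rewrite natrM natrX /=.
(* The ratio M/K is at most 2 2^(N(r1 + 4 eta)) + 1, and the quotient count adds 1 more. The sum is
   at most 4 2^(N(r1 + 4 eta)), and 4 is at most 2^(N eta). *)
have Ale : A%:R <= 2 `^ (N%:R * (r1 + 5 * eta)) :> R.
  have A1 : A%:R <= M%:R / K%:R + 1 :> R.
    by rewrite /A -natr1 lerD2r ler_pdivlMr // -natrM ler_nat leq_trunc_div.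
  have M1 : M%:R / K%:R <= (2 `^ (N%:R * (Ixu + 2 * eta)) + 1) / K%:R :> R.
    by rewrite ler_wpM2r ?invr_ge0 ?(ltW K0r) // /M -natr1 lerD2r.
  have K1 : 1 / K%:R <= 1 :> R by rewrite ler_pdivrMr // mul1r ler1n.
  have I1 : 2 `^ (N%:R * (Ixu + 2 * eta)) / K%:R <= 2 * 2 `^ (N%:R * (r1 + 4 * eta)) :> R.
    rewrite ler_pdivrMr //.
    apply: (@le_trans _ _ (2 `^ (N%:R * (r1 + 4 * eta)) * kap)).
      by rewrite -powR2D; apply: le_powR2; rewrite -mulrDr ler_pM2l //; lra.
    by have := ler_wpM2l (ltW (powR2_gt0 (N%:R * (r1 + 4 * eta)))) Kge; lra.
  have R1 : 1 <= 2 `^ (N%:R * (r1 + 4 * eta)) :> R.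
    rewrite -[leLHS](powRr0 2); apply: le_powR2.
    by rewrite mulr_ge0 ?(ltW N0r) // addr_ge0 // mulr_ge0 // ltW.
  apply: (@le_trans _ _ (4 * 2 `^ (N%:R * (r1 + 4 * eta)))); first by lra.
  rewrite (_ : r1 + 5 * eta = eta + (r1 + 4 * eta)); last by ring.
  by rewrite [X in _ <= 2 `^ X]mulrDr powR2D ler_wpM2r // ltW // powR2_gt0.
have KB : K%:R <= 2 `^ (N%:R * (B%:R * eta)) :> R.
  case: Kle => [->|Kle].
    rewrite -[leLHS](powRr0 2); apply: le_powR2.
    by rewrite !mulr_ge0 // ltW.
  apply: (le_trans Kle); apply: le_powR2; rewrite ler_pM2l //.
  by have := ler_norm Hvxu; lra.
apply: (@le_trans _ _ ((2 `^ (N%:R * (r1 + 5 * eta))) ^+ B * 2 `^ (N%:R * (B%:R * eta)))).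
  by apply: ler_pM => //; rewrite lerXn2r ?nnegrE ?(ltW (powR2_gt0 _)).
rewrite powR2X -powR2D; apply: le_powR2.
rewrite natrM (_ : _ + _ = B%:R * N%:R * (r1 + 6 * eta)); last by ring.
by rewrite ler_wpM2l ?mulr_ge0 ?(ltW B0r) ?(ltW N0r) //; lra.
Qed.

End Corner.

Section RegionAchievable.
Variable R : realType.

Lemma region_achievable (X X1 X2 : finType) (PX : {ffun X -> R})
    (d1 : X -> X1 -> R) (d2 : X -> X2 -> R) (D1 D2 : R) (r : R * R) :
  (forall x a, 0 <= d1 x a) -> (forall x b, 0 <= d2 x b) ->
  sr_region PX d1 d2 D1 D2 r ->
  forall delta, 0 < delta -> achievable PX d1 d2 D1 D2 (r.1 + delta, r.2 + delta).
Proof.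
move=> d10 d20 [r20 [U [P [f [_ [Ppmf [mP [hD1 [hD2 [hI]]]]]]]]]].
rewrite ge_max => /andP[hIH r10].
have [P0 P1] := Ppmf; set H := condent (marg2 P) in hIH *.
have H0 : 0 <= H by apply: condent_ge0; exact: marg2_ge0.
(* If H exceeds R1, this [l] makes (1 - l)H equal to R1, and the sum-rate constraint gives the bound
   on R0. Otherwise nothing is revealed and the constraint on R0 itself applies. *)
pose l := if H <= r.2 then 0 else 1 - r.2 / H.
have [l01 lH lI] : [/\ 0 <= l <= 1, (1 - l) * H <= r.2 & mutinfo P - (1 - l) * H <= r.1].
  rewrite /l; case: (leP H r.2) => HR.
    by split; rewrite ?lexx ?ler01 ?subr0 ?mul1r.
  have Hp : 0 < H by lra.
  rewrite subKr divfK ?gt_eqF //; split => //; last by lra.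
  by rewrite subr_ge0 ler_pdivrMr // mul1r (ltW HR) /= gerBl divr_ge0 // ltW.
have [P' [P'pmf m1 mi ce P'F]] := reveal_auxiliary Ppmf l01.
rewrite -mP -m1; apply: (achievable_corner (f := fun u => f u.1) P'pmf) => //.
- by rewrite (P'F (fun x v u => d1 x v)).
- by rewrite (P'F (fun x v u => d2 x (f u v))).
- by rewrite mi ce.
- by rewrite ce.
Qed.

End RegionAchievable.

(** * Converse for a single code *)

Section FunctionEntropy.
Variables (R : realType) (W : finType) (p : W -> R).
Hypotheses (p0 : forall w, 0 <= p w) (p1 : \sum_w p w = 1).

Lemma expect_const (c : R) : \sum_w p w * c = c.
Proof. by rewrite -mulr_suml p1 mul1r. Qed.

Lemma ln_le_subr1 (x : R) : 0 < x -> ln x <= x - 1.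
Proof. by move=> x0; have := @le_ln1Dx R (x - 1); rewrite [1 + _]addrC subrK; apply; lra. Qed.

Lemma log2_le (x y : R) : 0 < x -> x <= y -> log2 x <= log2 y.
Proof.
move=> x0 xy; rewrite /log2 ler_pM2r ?invr_gt0 ?ln2_gt0 // ler_ln ?posrE //.
exact: lt_le_trans xy.
Qed.

(* [hent f] is the entropy of the random variable [f], written through the probabilities of
   its fibers so that its values may lie in an infinite type. *)
Definition fiber_pr (A : eqType) (f : W -> A) (w : W) : R := \sum_(w' | f w' == f w) p w'.

Definition hent (A : eqType) (f : W -> A) : R := - \sum_w p w * log2 (fiber_pr f w).

Lemma le_fiber_pr (A : eqType) (f : W -> A) w : p w <= fiber_pr f w.
Proof. by rewrite /fiber_pr (bigD1 w) //= lerDl sumr_ge0. Qed.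

Lemma fiber_pr_ge0 (A : eqType) (f : W -> A) w : 0 <= fiber_pr f w.
Proof. exact: sumr_ge0. Qed.

(** [f] is a function of [g], so its fibers are unions of fibers of [g] and have larger
    probability. *)
Lemma le_hent (A B : eqType) (f : W -> A) (g : W -> B) :
  (forall w w', g w = g w' -> f w = f w') -> hent f <= hent g.
Proof.
move=> E; rewrite lerN2; apply: ler_sum => w _.
have [->|pn] := eqVneq (p w) 0; first by rewrite !mul0r.
have pw : 0 < p w by rewrite lt_neqAle eq_sym pn p0.
rewrite ler_pM2l // log2_le ?(lt_le_trans pw) ?le_fiber_pr //.
rewrite /fiber_pr [leRHS](bigID (fun w' => g w' == g w)) /=.
rewrite [X in _ <= X + _](eq_bigl (fun w' => g w' == g w)) ?lerDl ?sumr_ge0 //.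
by move=> w'; case: (g w' =P g w) => [/E ->|]; rewrite ?eqxx ?andbF.
Qed.

(** Jensen's inequality by way of ln x <= x - 1; it yields both the cardinality bound and
    submodularity. *)
Lemma hent_sum_log_le0 (r : W -> R) :
  (forall w, 0 < p w -> 0 < r w) -> \sum_w p w * r w <= 1 -> \sum_w p w * log2 (r w) <= 0.
Proof.
move=> r0 s1; apply: (@le_trans _ _ (\sum_w (p w * r w - p w) / ln 2)).
  apply: ler_sum => w _; rewrite /log2 mulrA ler_pM2r ?invr_gt0 ?ln2_gt0 //.
  have [->|pn] := eqVneq (p w) 0; first by rewrite !mul0r subr0.
  have pw : 0 < p w by rewrite lt_neqAle eq_sym pn p0.
  by rewrite -[X in _ - X]mulr1 -mulrBr ler_pM2l // ln_le_subr1 // r0.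
by rewrite -mulr_suml sumrB p1 pmulr_lle0 ?invr_gt0 ?ln2_gt0 // subr_le0.
Qed.

(** Comparison with the uniform law: the expectation of 1/(|A| P(f)) is at most 1, as each value of
    [f] contributes at most 1/|A|. *)
Lemma hent_card (A : finType) (f : W -> A) : hent f <= log2 #|A|%:R.
Proof.
have [w0 _] : exists w0 : W, true.
  case: (pickP (fun _ : W => true)) => [w _|W0]; first by exists w.
  by move: p1; rewrite big_pred0 // => /esym/eqP; rewrite oner_eq0.
have A0 : 0 < #|A|%:R :> R by rewrite ltr0n; apply/card_gt0P; exists (f w0).
have fp w : 0 < p w -> 0 < fiber_pr f w by move=> pw; exact: lt_le_trans (le_fiber_pr f w).
have H : \sum_w p w * log2 ((fiber_pr f w * #|A|%:R)^-1) <= 0.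
  apply: hent_sum_log_le0 => [w pw|]; first by rewrite invr_gt0 mulr_gt0 // fp.
  rewrite (eq_bigr (fun w => p w / fiber_pr f w / #|A|%:R)); last first.
    by move=> w _; rewrite invfM mulrA.
  rewrite -mulr_suml ler_pdivrMr // mul1r (partition_big f predT) //=.
  rewrite -[leRHS]mulr1 mulr_natl -[X in _ <= _ *+ X]/(#|predT : pred A|) -sumr_const.
  apply: ler_sum => a _; rewrite (eq_bigr (fun w => p w / \sum_(w | f w == a) p w)); last first.
    by move=> w /eqP <-.
  rewrite -mulr_suml; have [->|sn] := eqVneq (\sum_(w | f w == a) p w) 0.
    by rewrite mul0r ler01.
  by rewrite mulfV.
suff -> : hent f = \sum_w p w * log2 ((fiber_pr f w * #|A|%:R)^-1) + log2 #|A|%:R by rewrite gerDr.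
rewrite -[X in _ + X]expect_const -big_split /hent -sumrN; apply: eq_bigr => w _ /=.
have [->|pn] := eqVneq (p w) 0; first by rewrite !mul0r oppr0 addr0.
have pw : 0 < p w by rewrite lt_neqAle eq_sym pn p0.
by rewrite log2V ?mulr_gt0 ?fp // log2M ?fp //; ring.
Qed.

(** Nonnegativity of I(f;h|g): the expectation of P(f,g) P(g,h) / (P(f,g,h) P(g)) is at most 1. *)
Lemma hent_submod (A B C : eqType) (f : W -> A) (g : W -> B) (h : W -> C) :
  hent (fun w => (f w, g w, h w)) + hent g <=
  hent (fun w => (f w, g w)) + hent (fun w => (g w, h w)).
Proof.
pose a := fiber_pr (fun w => (f w, g w)); pose b := fiber_pr (fun w => (g w, h w)).
pose c := fiber_pr (fun w => (f w, g w, h w)); pose d := fiber_pr g.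
have pos w : 0 < p w -> [/\ 0 < a w, 0 < b w, 0 < c w & 0 < d w].
  by move=> pw; split; apply: lt_le_trans pw _; exact: le_fiber_pr.
suff H : \sum_w p w * log2 (a w * b w / (c w * d w)) <= 0.
  rewrite -subr_le0; apply: le_trans H; rewrite /hent -!sumrN -!big_split /= -sumrN -big_split /=.
  apply: ler_sum => w _ /=.
  have [->|pn] := eqVneq (p w) 0; first by rewrite !(mul0r, oppr0, addr0).
  have pw : 0 < p w by rewrite lt_neqAle eq_sym pn p0.
  have [? ? ? ?] := pos _ pw.
  rewrite log2_div ?mulr_gt0 // !log2M // le_eqVlt; apply/orP; left; apply/eqP.
  by rewrite /a /b /c /d; ring.
apply: hent_sum_log_le0 => [w /pos[? ? ? ?]|]; first by rewrite divr_gt0 ?mulr_gt0.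
(* Expand [a] and [b] as sums over [w1] and [w2]. For a fixed pair the related [w] form at most one
   fiber of (f,g,h), whose mass cancels [c]; summing over [w2] then cancels [d]. *)
pose rel w w1 w2 := ((f w1, g w1) == (f w, g w)) && ((g w2, h w2) == (g w, h w)).
have E w : p w * (a w * b w / (c w * d w)) =
    \sum_w1 \sum_w2 (if rel w w1 w2 then p w1 * p w2 * (p w / (c w * d w)) else 0).
  rewrite (_ : p w * _ = a w * b w * (p w / (c w * d w))); last by ring.
  rewrite /a /fiber_pr big_mkcond mulr_suml mulr_suml; apply: eq_bigr => w1 _.
  rewrite /b /fiber_pr big_mkcond mulr_sumr mulr_suml; apply: eq_bigr => w2 _.
  rewrite /rel; case: ((f w1, g w1) == _) => /=; last by rewrite !mul0r.
  by case: ((g w2, h w2) == _) => /=; rewrite ?mulr0 ?mul0r.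
rewrite (eq_bigr _ (fun w _ => E w)) exchange_big /=.
apply: (@le_trans _ _ (\sum_w1 \sum_(w2 | g w2 == g w1) p w1 * p w2 / d w1)); last first.
  rewrite -p1; apply: ler_sum => w1 _; rewrite -mulr_suml -mulr_sumr -/(fiber_pr g w1) -/(d w1).
  have [->|dn] := eqVneq (d w1) 0; first by rewrite mulr0 mul0r.
  by rewrite mulfK.
apply: ler_sum => w1 _; rewrite exchange_big [leRHS]big_mkcond /=; apply: ler_sum => w2 _.
rewrite -big_mkcond -mulr_sumr /=.
have dinv : 0 <= (d w1)^-1 by rewrite invr_ge0 fiber_pr_ge0.
case: (pickP (rel ^~ w1 ^~ w2)) => [w0 r0|nor]; last first.
  rewrite big_pred0 // mulr0; case: ifP => // _; exact: mulr_ge0 (mulr_ge0 _ _) _.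
have /andP[/eqP[f1 g1] /eqP[g2 h2]] := r0.
rewrite g2 g1 eqxx ler_wpM2l ?mulr_ge0 //.
rewrite (eq_bigr (fun w => p w / (c w0 * d w1))); last first.
  move=> w /andP[/eqP[f1' g1'] /eqP[g2' h2']].
  rewrite /c /d /fiber_pr -f1' -g1' -h2' g1 f1 h2; congr (_ / (_ * _)).
rewrite -mulr_suml (eq_bigl (fun w => (f w, g w, h w) == (f w0, g w0, h w0))); last first.
  move=> w; rewrite /rel !xpair_eqE f1 g1 g2 h2.
  rewrite (eq_sym (f w0)) (eq_sym (g w0)) (eq_sym (h w0)).
  by case: (f w == _) => //; case: (g w == _).
rewrite -/(fiber_pr (fun w => (f w, g w, h w)) w0) -/(c w0) invfM mulrA.
have [->|cn] := eqVneq (c w0) 0; first by rewrite !mul0r.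
by rewrite mulfV // mul1r.
Qed.

(* The law of [Z I w] for a uniform index [I] independent of [w]. *)
Definition mixture n (A : eqType) (Z : 'I_n -> W -> A) (t : A) : R :=
  n%:R^-1 * \sum_i \sum_(w | Z i w == t) p w.

Lemma mixture_ge0 n (A : eqType) (Z : 'I_n -> W -> A) t : 0 <= mixture Z t.
Proof. by rewrite mulr_ge0 ?invr_ge0 // sumr_ge0 // => i _; rewrite sumr_ge0. Qed.

Lemma mixture_expect n (A : finType) (Z : 'I_n -> W -> A) (F : A -> R) :
  \sum_t mixture Z t * F t = n%:R^-1 * \sum_i \sum_w p w * F (Z i w).
Proof.
under eq_bigr do rewrite /mixture -mulrA mulr_suml.
rewrite -mulr_sumr exchange_big /=; congr (_ * _); apply: eq_bigr => i _.
rewrite [RHS](partition_big (Z i) predT) //=; apply: eq_bigr => t _.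
by rewrite mulr_suml; apply: eq_bigr => w /eqP ->.
Qed.

(** The value of [Z] reveals the index, so the atoms of the mixture are those of the [Z i] divided
    by n. The term log n is common to all such mixtures and cancels in information quantities. *)
Lemma mixture_Ent n (A : finType) (Z : 'I_n -> W -> A) : (0 < n)%N ->
  (forall i i' w w', Z i w = Z i' w' -> i = i') ->
  Ent (mixture Z) = log2 n%:R + n%:R^-1 * \sum_i hent (Z i).
Proof.
move=> n0 Zinj; rewrite /Ent (mixture_expect Z (fun t => log2 (mixture Z t))).
have nr : 0 < n%:R :> R by rewrite ltr0n.
have fE i w : mixture Z (Z i w) = n%:R^-1 * fiber_pr (Z i) w.
  rewrite /mixture (bigD1 i) //= [X in _ + X]big1 ?addr0 // => i' ii'.
  by rewrite big_pred0 // => w'; apply/eqP => /Zinj E; rewrite E eqxx in ii'.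
have E i : \sum_w p w * log2 (mixture Z (Z i w)) = - (hent (Z i) + log2 n%:R).
  rewrite opprD /hent opprK -[X in _ - X]expect_const -sumrB.
  apply: eq_bigr => w _; rewrite fE.
  have [->|pn] := eqVneq (p w) 0; first by rewrite !mul0r subr0.
  have pw : 0 < p w by rewrite lt_neqAle eq_sym pn p0.
  have fp : 0 < fiber_pr (Z i) w by exact: lt_le_trans pw (le_fiber_pr _ _).
  by rewrite log2M ?invr_gt0 // log2V //; ring.
rewrite (eq_bigr _ (fun i _ => E i)) sumrN big_split /= sumr_const card_ord.
by rewrite mulrN opprK mulrDr -[log2 _ *+ n]mulr_natl mulKf ?gt_eqF // addrC.
Qed.

Lemma mixture_marg2 n (A B : finType) (Z : 'I_n -> W -> A * B) :
  marg2 [ffun t => mixture Z t] = [ffun t => mixture (fun i w => (Z i w).2) t].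
Proof.
apply/ffunP => b; rewrite !ffunE; under eq_bigr do rewrite ffunE.
rewrite /mixture -mulr_sumr exchange_big /=; congr (_ * _); apply: eq_bigr => i _.
rewrite [RHS](partition_big (fun w => (Z i w).1) predT) //=; apply: eq_bigr => a _.
by apply: eq_bigl => w; rewrite andbC -xpair_eqE -surjective_pairing.
Qed.

End FunctionEntropy.

(** * Single-letter bounds for a code *)

Section CodeConverse.
Variables (R : realType) (X X1 X2 : finType) (PX : {ffun X -> R}).
Hypothesis PXpmf : is_pmf PX.

Lemma take_succ_eq (T : eqType) n (s s' : n.-tuple T) (i : 'I_n) :
  take i.+1 s = take i.+1 s' <-> take i s = take i s' /\ tnth s i = tnth s' i.
Proof.
pose x0 := tnth s i.
rewrite !(take_nth x0) ?size_tuple ?ltn_ord // !(tnth_nth x0); split; last by case=> -> ->.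
by move=> /eqP; rewrite eqseq_rcons => /andP[/eqP -> /eqP ->].
Qed.

Lemma log2_prod (I : finType) (F : I -> R) : (forall i, 0 < F i) ->
  log2 (\prod_i F i) = \sum_i log2 (F i).
Proof.
move=> F0; have : 0 < \prod_i F i /\ log2 (\prod_i F i) = \sum_i log2 (F i); last by case.
apply: (big_rec2 (fun q s => 0 < q /\ log2 q = s)) => [|i q s _ [q0 <-]]; first by rewrite log2_1.
by rewrite mulr_gt0 // log2M.
Qed.

Lemma hent_coord n (i : 'I_n) :
  hent (iid PX (n := n)) (fun x => tnth x i) = Ent PX.
Proof.
rewrite /hent /Ent -(iid_marginal1 PXpmf i (fun t => log2 (PX t))); congr (- _).
apply: eq_bigr => x _; congr (_ * log2 _).
transitivity (\sum_(x' : n.-tuple X) iid PX x' * (tnth x' i == tnth x i)%:R).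
  by rewrite /fiber_pr big_mkcond; apply: eq_bigr => x' _; case: eqP => _; rewrite ?mulr1 ?mulr0.
rewrite (iid_marginal1 PXpmf i (fun t => (t == tnth x i)%:R)) (bigD1 (tnth x i)) //=.
by rewrite eqxx mulr1 big1 ?addr0 // => t /negbTE ->; rewrite mulr0.
Qed.

Lemma hent_iid n : hent (iid PX (n := n)) id = n%:R * Ent PX.
Proof.
transitivity (\sum_(i < n) hent (iid PX (n := n)) (fun x => tnth x i)); last first.
  by under eq_bigr do rewrite hent_coord; rewrite sumr_const card_ord mulr_natl.
transitivity (- \sum_(x : n.-tuple X) iid PX x * \sum_i log2 (PX (tnth x i))).
  congr (- _); apply: eq_bigr => x _; rewrite /fiber_pr big_pred1_eq.
  have [->|nz] := eqVneq (iid PX x) 0; first by rewrite !mul0r.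
  rewrite /iid log2_prod // => j; rewrite lt_neqAle eq_sym.
  have [PX0 _] := PXpmf; rewrite PX0 andbT; apply: contraNneq nz => PXj.
  by rewrite /iid (bigD1 j) //= PXj mul0r.
under eq_bigr do rewrite mulr_sumr.
rewrite exchange_big -sumrN /=; apply: eq_bigr => i _.
by rewrite hent_coord /Ent (iid_marginal1 PXpmf i (fun t => log2 (PX t))).
Qed.

Lemma le_log2_card (n M : nat) (r : R) : (0 < M)%N ->
  M%:R <= 2 `^ (n%:R * r) -> log2 M%:R <= n%:R * r.
Proof.
move=> M0 Mr; apply: (@le_trans _ _ (log2 (2 `^ (n%:R * r)))).
  by apply: log2_le => //; rewrite ltr0n.
by rewrite /log2 ln_powR mulfK // gt_eqF // ln2_gt0.
Qed.

Lemma code_converse (d1 : X -> X1 -> R) (d2 : X -> X2 -> R) (D1 D2 r1 r2 : R) (n M0 M1 : nat)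
    (f0 : n.-tuple X -> 'I_M0) (f1 : n.-tuple X -> 'I_M1)
    (g1 : 'I_M0 -> 'I_M1 -> n.-tuple X1) (g2 : 'I_n -> 'I_M0 -> seq X1 -> X2) :
  let xh1 := fun x => g1 (f0 x) (f1 x) in
  (0 < n)%N -> M0%:R <= 2 `^ (n%:R * r1) -> M1%:R <= 2 `^ (n%:R * r2) ->
  exp_dist PX d1 (fun x j => tnth (xh1 x) j) <= D1 ->
  exp_dist PX d2 (fun x j => g2 j (f0 x) (take j.+1 (val (xh1 x)))) <= D2 ->
  exists (U : finType) (P : {ffun X * (X1 * U) -> R}) (f : U -> X1 -> X2),
    is_pmf P /\ marg1 P = PX /\
    \sum_t P t * d1 t.1 t.2.1 <= D1 /\
    \sum_t P t * d2 t.1 (f t.2.2 t.2.1) <= D2 /\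
    mutinfo P <= r1 + r2 /\ mutinfo P - condent (marg2 P) <= r1.
Proof.
move=> xh n0 hM0 hM1 hD1 hD2.
have nr : 0 < n%:R :> R by rewrite ltr0n.
have [x0 _] : exists x0 : n.-tuple X, true.
  case: (pickP (fun _ : n.-tuple X => true)) => [x0 _|N]; first by exists x0.
  by have := sum_iid PXpmf n; rewrite big_pred0 // => /esym/eqP; rewrite oner_eq0.
pose p := iid PX (n := n).
have p0 : forall x, 0 <= p x by exact: iid_ge0.
have p1 : \sum_x p x = 1 by exact: sum_iid.
have take_le (i : nat) x : (size (take i (xh x)) <= n)%N.
  by rewrite size_take size_tuple; case: ltnP => // /ltnW.
pose U : finType := ('I_n * 'I_M0 * n.-bseq X1)%type.
pose Z (i : 'I_n) x : X * (X1 * U) :=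
  (tnth x i, (tnth (xh x) i, (i, f0 x, Bseq (take_le i x)))).
pose P : {ffun X * (X1 * U) -> R} := [ffun t => mixture p Z t].
(* Appending the current letter to the stored prefix restores exactly what Decoder 2 observes at
   that time. *)
pose f (u : U) (a : X1) : X2 := g2 u.1.1 u.1.2 (rcons u.2 a).
have P0 t : 0 <= P t by rewrite ffunE mixture_ge0.
have PE F : \sum_t P t * F t = n%:R^-1 * \sum_i \sum_x p x * F (Z i x).
  by under eq_bigr do rewrite ffunE; exact: mixture_expect.
have m1 : marg1 P = PX.
  apply/ffunP => a; rewrite ffunE.
  transitivity (\sum_t P t * (t.1 == a)%:R).
    rewrite [RHS]sum_pair [RHS](bigD1 a) //= [X in _ + X]big1 ?addr0 => [|b /negbTE ba].
      by apply: eq_bigr => b _; rewrite eqxx mulr1.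
    by apply: big1 => c _; rewrite ba mulr0.
  rewrite PE; under eq_bigr do rewrite /= (iid_marginal1 PXpmf _ (fun t => (t == a)%:R)).
  rewrite sumr_const card_ord -[X in _ * X]mulr_natl mulKf ?gt_eqF //.
  rewrite (bigD1 a) //= eqxx mulr1 big1 ?addr0 // => b /negbTE ->.
  by rewrite mulr0.
(* [b k] is H(T0, V^k) and [e k] is H(T0, V^n, X^k); both sums over time telescope. *)
pose b k := hent p (fun x => (f0 x, take k (xh x))).
pose e k := hent p (fun x => (f0 x, xh x, take k x)).
have eqH (A B : eqType) (g : n.-tuple X -> A) (h : n.-tuple X -> B) :
    (forall x x', g x = g x' <-> h x = h x') -> hent p g = hent p h.
  by move=> gh; apply/le_anti/andP; split; apply: le_hent => // x x' /gh.
have hVU i : hent p (fun x => (Z i x).2) = b i.+1.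
  apply: eqH => x x'; split => [[v t s]|[t /take_succ_eq[s v]]].
    by congr (_, _) => //; apply/take_succ_eq.
  by rewrite /Z /= v t; congr (_, (_, _, _)); exact: val_inj.
have hU i : hent p (fun x => (Z i x).2.2) = b i.
  apply: eqH => x x'; split => [[t s]|[t s]]; first by rewrite t s.
  by rewrite /Z /= t; congr (_, _, _); exact: val_inj.
(* Submodularity applied to X_i, (T0, V^i) and (V^n, X^(i-1)): enlarging the second argument of the
   information about X_i to (T0, V^n, X^(i-1)) cannot decrease it. *)
have step i : hent p (fun x => tnth x i) + b i.+1 - hent p (Z i) <=
    hent p (fun x => tnth x i) + e i - e i.+1.
  have := hent_submod p0 p1 (fun x => tnth x i) (fun x => (f0 x, take i.+1 (xh x)))
    (fun x => (xh x, take i x)).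
  rewrite (eqH _ _ _ (fun x => (f0 x, xh x, take i.+1 x))); last first.
    move=> x x'; split => [[a t _ v s]|[t v /take_succ_eq[s a]]].
      by rewrite t v; congr (_, _); apply/take_succ_eq.
    by rewrite a t v s.
  rewrite (eqH _ _ (fun x => (tnth x i, (f0 x, take i.+1 (xh x)))) (Z i)); last first.
    move=> x x'; split => [[a t /take_succ_eq[s v]]|[a v t s]].
      by rewrite /Z a v t; congr (_, (_, (_, _, _))); exact: val_inj.
    by rewrite a t; congr (_, (_, _)); apply/take_succ_eq.
  rewrite (eqH _ _ (fun x => (f0 x, take i.+1 (xh x), (xh x, take i x)))
    (fun x => (f0 x, xh x, take i x))); last first.
    move=> x x'; split => [[t _ v s]|[t v s]]; first by rewrite t v s.
    by rewrite t v s.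
  by rewrite -/(b i.+1) -/(e i.+1) -/(e i); lra.
have e0 : e 0%N = b n.
  apply: eqH => x x'; split => [[t v _]|[t v]]; first by rewrite t v.
  by rewrite !take_oversize ?size_tuple // in v; rewrite t (val_inj v) !take0.
have en : n%:R * Ent PX <= e n.
  rewrite -hent_iid; apply: le_hent => // x x' [_ _].
  by rewrite !take_oversize ?size_tuple // => /val_inj.
have b0 : b 0%N = hent p f0.
  by apply: eqH => x x'; split => [[t _]|t]; rewrite ?t // !take0.
have lM0 : hent p f0 <= n%:R * r1.
  apply: le_trans (hent_card p0 p1 f0) _; rewrite card_ord; apply: le_log2_card hM0.
  exact: leq_ltn_trans (leq0n _) (ltn_ord (f0 x0)).
have lM01 : b n <= n%:R * (r1 + r2).
  apply: (@le_trans _ _ (hent p (fun x => (f0 x, f1 x)))).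
    by apply: le_hent => // x x' [t t']; rewrite /xh t t'.
  apply: le_trans (hent_card p0 p1 _) _; rewrite card_prod !card_ord; apply: le_log2_card.
    by rewrite muln_gt0 (leq_ltn_trans (leq0n _) (ltn_ord (f0 x0)))
      (leq_ltn_trans (leq0n _) (ltn_ord (f1 x0))).
  by rewrite natrM mulrDr powR2D ler_pM.
have tele g : \sum_(i < n) (g i.+1 - g i) = g n - g 0%N :> R.
  by rewrite -(big_mkord predT (fun i => g i.+1 - g i)) telescope_sumr.
have Z1inj i i' x x' : Z i x = Z i' x' -> i = i' by case.
have Z2inj i i' x x' : (Z i x).2 = (Z i' x').2 -> i = i' by case.
have Z3inj i i' x x' : (Z i x).2.2 = (Z i' x').2.2 -> i = i' by case.
have EP : Ent P = log2 n%:R + n%:R^-1 * \sum_i hent p (Z i).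
  by rewrite -(mixture_Ent p0 p1 n0 Z1inj); apply: eq_Ent => t; rewrite ffunE.
have EVU : Ent (marg2 P) = log2 n%:R + n%:R^-1 * \sum_(i < n) b i.+1.
  under eq_bigr do rewrite -hVU.
  rewrite -(mixture_Ent p0 p1 n0 Z2inj) /P mixture_marg2.
  by apply: eq_Ent => t; rewrite ffunE.
have EU : Ent (marg2 (marg2 P)) = log2 n%:R + n%:R^-1 * \sum_(i < n) b i.
  under eq_bigr do rewrite -hU.
  rewrite -(mixture_Ent p0 p1 n0 Z3inj) /P mixture_marg2 mixture_marg2.
  by apply: eq_Ent => t; rewrite ffunE.
(* The telescoped bound is n H(X) + e 0 - e n. Here e 0 = b n, and e n is at least H(X^n) = n
   H(X). *)
have nI : n%:R * mutinfo P <= b n.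
  rewrite mutinfoE // m1 EP EVU.
  rewrite (_ : n%:R * _ = n%:R * Ent PX + \sum_(i < n) b i.+1 - \sum_i hent p (Z i)); last first.
    by field; rewrite gt_eqF.
  have : \sum_(i < n) (hent p (fun x => tnth x i) + b i.+1 - hent p (Z i)) <=
      \sum_(i < n) (hent p (fun x => tnth x i) + e i - e i.+1) by exact: ler_sum.
  have sumDB (u v w : 'I_n -> R) :
      \sum_i (u i + v i - w i) = \sum_i u i + \sum_i v i - \sum_i w i.
    by rewrite sumrB big_split.
  have := tele e; rewrite sumrB e0 (sumDB _ (fun i => b i.+1)) (sumDB _ (fun i => e i)).
  have -> : \sum_(i < n) hent p (fun x => tnth x i) = n%:R * Ent PX.
    by under eq_bigr do rewrite hent_coord; rewrite sumr_const card_ord mulr_natl.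
  by lra.
(* Subtracted from [nI], this leaves b 0 = H(T0), which the common rate bounds. *)
have nH : n%:R * condent (marg2 P) = b n - b 0%N.
  rewrite condentE; last exact: marg2_ge0.
  by rewrite EVU EU -tele sumrB; field; rewrite gt_eqF.
exists U, P, f; split; [split => //|split => //; split; [|split; [|split]]].
- transitivity (\sum_t P t * 1); first by under [RHS]eq_bigr do rewrite mulr1.
  rewrite PE; under eq_bigr do under eq_bigr do rewrite mulr1.
  under eq_bigr do rewrite p1.
  by rewrite sumr_const card_ord mulVf // gt_eqF.
- rewrite PE; apply: le_trans hD1; rewrite /exp_dist exchange_big mulr_sumr le_eqVlt.
  apply/orP; left; apply/eqP; apply: eq_bigr => x _.
  by rewrite [RHS]mulrCA; congr (_ * _); rewrite mulr_sumr.
- rewrite PE; apply: le_trans hD2; rewrite /exp_dist exchange_big mulr_sumr le_eqVlt.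
  apply/orP; left; apply/eqP; apply: eq_bigr => x _.
  rewrite [RHS]mulrCA; congr (_ * _); rewrite mulr_sumr; apply: eq_bigr => i _.
  congr (_ * d2 _ _); rewrite /f /= (take_nth (tnth (xh x) i)) ?size_tuple ?ltn_ord //.
  by rewrite -tnth_nth.
- by rewrite -(ler_pM2l nr) (le_trans nI).
- rewrite -(ler_pM2l nr) mulrBr nH; lra.
Qed.

End CodeConverse.

(** * Alphabet reduction and limit *)

Section ConicCaratheodory.
Variable R : realType.

(** More vectors than coordinates have a nontrivial left kernel. Its element is extended by zero
    outside [S], with the sign chosen so that some coefficient is positive. *)
Lemma linear_dependence (T I : finType) (S : {set T}) (A : T -> I -> R) : (#|I| < #|S|)%N ->
  exists l : T -> R, [/\ forall t, t \notin S -> l t = 0,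
    forall i, \sum_t l t * A t i = 0 & exists t, 0 < l t].
Proof.
move=> IS.
suff [l [lS lA [t lt]]] : exists l : T -> R, [/\ forall t, t \notin S -> l t = 0,
    forall i, \sum_t l t * A t i = 0 & exists t, l t != 0].
  have [l0|l0|/eqP l0] := ltgtP (l t) 0; last by rewrite l0 in lt.
  - exists (fun t => - l t); split; last by exists t; rewrite oppr_gt0.
      by move=> t' /lS ->; rewrite oppr0.
    by move=> i; under eq_bigr do rewrite mulNr; rewrite sumrN lA oppr0.
  - by exists l; split => //; exists t.
pose M : 'M[R]_(#|S|, #|I|) := \matrix_(i, j) A (enum_val i) (enum_val j).
have : kermx M != 0.
  by rewrite kermx_eq0 /row_free neq_ltn (leq_ltn_trans (rank_leq_col M)).
move=> /matrix0Pn[i0 [j0 kij]].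
pose l t : R := if [pick j | enum_val j == t] is Some j then kermx M i0 j else 0.
have lE (j : 'I_#|S|) : l (enum_val j) = kermx M i0 j.
  rewrite /l; case: pickP => [j' /eqP/enum_val_inj -> //|/(_ j)].
  by rewrite eqxx.
exists l; split; last by exists (enum_val j0); rewrite lE.
  move=> t tS; rewrite /l; case: pickP => // j /eqP E.
  by move: tS; rewrite -E enum_valP.
move=> i; rewrite (bigID (mem S)) /= [X in _ + X]big1 ?addr0; last first.
  move=> t tS; rewrite /l; case: pickP => [j /eqP E|_]; last by rewrite mul0r.
  by move: tS; rewrite -E enum_valP.
rewrite big_enum_val /=.
have := mulmx_ker M => /matrixP/(_ i0 (enum_rank i)); rewrite !mxE => E.
rewrite -[RHS]E; apply: eq_bigr => j _.
by rewrite lE !mxE enum_rankK.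
Qed.

(* A nonnegative solution of the linear system with minimal support: along a linear
   dependence of its support, move until a weight vanishes. *)
Lemma conic_caratheodory (T I : finType) (A : T -> I -> R) (w : T -> R) :
  (forall t, 0 <= w t) ->
  exists w' : T -> R, [/\ forall t, 0 <= w' t,
    forall i, \sum_t w' t * A t i = \sum_t w t * A t i &
    (#|[set t | w' t != 0%R]| <= #|I|)%N].
Proof.
move: {2}_.+1 (ltnSn #|[set t | w t != 0]|) => s.
elim: s w => // s IH w ws w0.
have [small|big] := leqP #|[set t | w t != 0]| #|I|; first by exists w.
have [l [lS lA [t1 lt1]]] := linear_dependence A big.
have [t0 lt0 tmin] := @arg_minP _ R T t1 (fun t => 0 < l t) (fun t => w t / l t) lt1.
(* The smallest ratio is the longest step that keeps all weights nonnegative; the weight at [t0]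
   vanishes there. *)
pose c := w t0 / l t0.
have c0 : 0 <= c by rewrite divr_ge0 // ltW.
pose w2 t := w t - c * l t.
have w20 t : 0 <= w2 t.
  rewrite /w2 subr_ge0; have [lt|lt] := ltP 0 (l t).
    by rewrite -ler_pdivlMr // tmin.
  by apply: le_trans (w0 t); rewrite mulr_ge0_le0.
have w2t0 : w2 t0 = 0 by rewrite /w2 /c divfK ?subrr // gt_eqF.
have supp : [set t | w2 t != 0] \proper [set t | w t != 0].
  rewrite properE; apply/andP; split.
    apply/fintype.subsetP => t; rewrite !inE; apply: contraNN => /eqP wt.
    by rewrite /w2 wt lS ?inE ?wt ?eqxx // mulr0 subrr.
  apply/fintype.subsetPn; exists t0; rewrite !inE ?w2t0 ?eqxx //.
  by apply/negP => /eqP wt0; have := lS t0; rewrite inE wt0 eqxx => /(_ isT) E; rewrite E ltxx in lt0.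
have [|//|w' [w'0 w'A w's]] := IH w2.
  by apply: leq_trans (proper_card supp) _; rewrite -ltnS.
exists w'; split => // i; rewrite w'A /w2.
under eq_bigr do rewrite mulrBl -mulrA.
by rewrite sumrB -mulr_sumr lA mulr0 subr0.
Qed.

End ConicCaratheodory.

(** * Reduction of the auxiliary alphabet *)

Section Compression.
Variable R : realType.

(** For the slice of a law at u this is - P(u) H(X|V,U=u), the contribution of u to I(X;V,U) -
    H(X). *)
Definition slice_info (X V : finType) (q : X * V -> R) : R :=
  Ent (fun v => \sum_x q (x, v)) - Ent q.

(** For the slice at u this is P(u) H(V|U=u). The total mass enters as an entropy over [unit], so
    that the scaling rule for [Ent] covers it too. *)
Definition slice_ent (X V : finType) (q : X * V -> R) : R :=
  Ent (fun v => \sum_x q (x, v)) - Ent (fun _ : unit => \sum_v \sum_x q (x, v)).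

Lemma slice_info_scale (X V : finType) (q : X * V -> R) (c : R) :
  0 <= c -> (forall t, 0 <= q t) -> slice_info (fun t => c * q t) = c * slice_info q.
Proof.
move=> c0 q0; rewrite /slice_info Ent_scale //.
rewrite (eq_Ent (q := fun v => c * \sum_x q (x, v))) => [|v]; last by rewrite mulr_sumr.
rewrite Ent_scale // => [|v]; last exact: sumr_ge0.
by rewrite sum_pair exchange_big /=; ring.
Qed.

Lemma slice_ent_scale (X V : finType) (q : X * V -> R) (c : R) :
  0 <= c -> (forall t, 0 <= q t) -> slice_ent (fun t => c * q t) = c * slice_ent q.
Proof.
move=> c0 q0; rewrite /slice_ent.
rewrite (eq_Ent (q := fun v => c * \sum_x q (x, v))) => [|v]; last by rewrite mulr_sumr.
rewrite (eq_Ent (p := fun _ : unit => _) (q := fun _ => c * \sum_v \sum_x q (x, v))); last first.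
  by move=> _; rewrite mulr_sumr; apply: eq_bigr => v _; rewrite mulr_sumr.
rewrite !Ent_scale // => [|_|v]; last exact: sumr_ge0.
  by rewrite (big_pred1 tt) => [|[]//]; ring.
by rewrite sumr_ge0 // => v _; rewrite sumr_ge0.
Qed.

Lemma Ent_slices (X V U : finType) (P : X * (V * U) -> R) :
  Ent P = \sum_u Ent (fun xv : X * V => P (xv.1, (xv.2, u))).
Proof.
rewrite /Ent sumrN; congr (- _); rewrite sum_pair.
under eq_bigr do rewrite sum_pair.
transitivity (\sum_x \sum_u \sum_v P (x, (v, u)) * log2 (P (x, (v, u)))).
  by apply: eq_bigr => x _; rewrite exchange_big.
rewrite exchange_big; apply: eq_bigr => u _.
by rewrite sum_pair.
Qed.

Lemma Ent_marg2_slices (X V U : finType) (P : {ffun X * (V * U) -> R}) :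
  Ent (marg2 P) = \sum_u Ent (fun v => \sum_x P (x, (v, u))).
Proof.
rewrite Ent_pair; apply: eq_bigr => u _; apply: eq_Ent => v.
by rewrite ffunE.
Qed.

Lemma mutinfo_slices (X V U : finType) (P : {ffun X * (V * U) -> R}) : (forall t, 0 <= P t) ->
  mutinfo P = Ent (marg1 P) + \sum_u slice_info (fun xv : X * V => P (xv.1, (xv.2, u))).
Proof.
by move=> P0; rewrite mutinfoE // Ent_slices Ent_marg2_slices -addrA -sumrB.
Qed.

Lemma condent_slices (X V U : finType) (P : {ffun X * (V * U) -> R}) : (forall t, 0 <= P t) ->
  condent (marg2 P) = \sum_u slice_ent (fun xv : X * V => P (xv.1, (xv.2, u))).
Proof.
move=> P0; rewrite condentE; last exact: marg2_ge0.
rewrite Ent_marg2_slices /slice_ent sumrB; congr (_ - _).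
rewrite /Ent -sumrN; apply: eq_bigr => u _; rewrite (big_pred1 tt) => [|[]//].
suff -> : marg2 (marg2 P) u = \sum_v \sum_x P (x, (v, u)) by [].
by rewrite ffunE; apply: eq_bigr => v _; rewrite ffunE.
Qed.

(** Places the retained letters in [k] numbered slots, the spare ones being empty. *)
Lemma sum_slots (U : eqType) (s : seq U) k (G : option U -> R) :
  (size s <= k)%N -> G None = 0 ->
  \sum_(j < k) G (nth None (map Some s) j) = \sum_(u <- s) G (Some u).
Proof.
move=> sk G0; rewrite -(big_mkord predT (fun j => G (nth None (map Some s) j))).
rewrite (@big_cat_nat _ _ _ (size s)) //= [X in _ + X]big1_seq ?addr0; last first.
  move=> j /andP[_]; rewrite mem_index_iota => /andP[sj _].
  by rewrite nth_default ?size_map.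
by rewrite -[RHS](big_map Some predT G) [RHS](big_nth None) size_map.
Qed.

(** Reweighting the slices must preserve |X| + 4 homogeneous functionals: the X-marginal, two
    entropy terms and two distortions. The marginal also fixes the total mass. The target ['I_k]
    depends on the source and reconstruction alphabets only, which the later limit requires. *)
Lemma compress_auxiliary (X X1 X2 U : finType) (P : {ffun X * (X1 * U) -> R}) (f : U -> X1 -> X2)
    (d1 : X -> X1 -> R) (d2 : X -> X2 -> R) :
  is_pmf P ->
  let k := (#|X| * #|X1| + 4)%N in
  exists (P' : {ffun X * (X1 * 'I_k) -> R}) (f' : 'I_k -> X1 -> X2),
    (forall t, 0 <= P' t) /\ marg1 P' = marg1 P /\
    \sum_t P' t * d1 t.1 t.2.1 = \sum_t P t * d1 t.1 t.2.1 /\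
    \sum_t P' t * d2 t.1 (f' t.2.2 t.2.1) = \sum_t P t * d2 t.1 (f t.2.2 t.2.1) /\
    mutinfo P' = mutinfo P /\ condent (marg2 P') = condent (marg2 P).
Proof.
move=> [P0 P1] k.
have [[x0 [v0 u0]] _] : exists t : X * (X1 * U), true.
  case: (pickP (fun _ : X * (X1 * U) => true)) => [t _|T0]; first by exists t.
  by move: P1; rewrite big_pred0 // => /esym/eqP; rewrite oner_eq0.
pose sl (u : U) (xv : X * X1) := P (xv.1, (xv.2, u)).
pose e1 (u : U) (xv : X * X1) := d1 xv.1 xv.2.
pose e2 u (xv : X * X1) := d2 xv.1 (f u xv.2).
pose A (u : U) (i : X + 'I_4) : R := match i with
  | inl x => \sum_v P (x, (v, u))
  | inr j => match val j with
    | 0 => slice_info (sl u)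
    | 1 => slice_ent (sl u)
    | 2 => \sum_xv sl u xv * e1 u xv
    | _ => \sum_xv sl u xv * e2 u xv
    end
  end.
(* The weights 1 represent [P] itself. *)
have [w [w0 wA wcard]] := @conic_caratheodory R U _ A (fun=> 1) (fun=> ler01).
pose s := enum [set u | w u != 0].
have sk : (size s <= k)%N.
  rewrite -cardE (leq_trans wcard) // card_sum card_ord leq_add2r.
  by rewrite leq_pmulr //; apply/card_gt0P; exists v0.
pose o (j : 'I_k) := nth None (map Some s) j.
have slots (F : U -> R) : (forall u, w u = 0 -> F u = 0) ->
    \sum_j oapp F 0 (o j) = \sum_u F u.
  move=> F0; rewrite (sum_slots (G := oapp F 0) sk) //= /s big_enum /= big_mkcond.
  by apply: eq_bigr => u _; rewrite inE; case: eqP => //= /F0.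
pose P' : {ffun X * (X1 * 'I_k) -> R} :=
  [ffun t => oapp (fun u => w u * P (t.1, (t.2.1, u))) 0 (o t.2.2)].
pose f' j := oapp f (f u0) (o j).
have P'0 t : 0 <= P' t by rewrite ffunE; case: (o _) => //= u; rewrite mulr_ge0.
have wAi i : \sum_u w u * A u i = \sum_u A u i.
  by rewrite wA; apply: eq_bigr => u _; rewrite mul1r.
have P'sl j : (fun xv : X * X1 => P' (xv.1, (xv.2, j))) =1
    (fun xv => oapp (fun u => w u * sl u xv) 0 (o j)) by move=> xv; rewrite ffunE.
have m1 : marg1 P' = marg1 P.
  apply/ffunP => x; rewrite !ffunE !sum_pair exchange_big [RHS]exchange_big /=.
  rewrite -[RHS](wAi (inl x)) -slots => [|u ->]; last by rewrite mul0r.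
  apply: eq_bigr => j _; under eq_bigr do rewrite ffunE /=.
  by case: (o j) => [u|] /=; [rewrite mulr_sumr|rewrite big1].
have dist (F : X -> X1 -> 'I_k -> R) (G : X -> X1 -> U -> R) (jj : 'I_4) :
    (forall j u x v, o j = Some u -> F x v j = G x v u) ->
    (forall u, A u (inr jj) = \sum_xv sl u xv * G xv.1 xv.2 u) ->
    \sum_t P' t * F t.1 t.2.1 t.2.2 = \sum_t P t * G t.1 t.2.1 t.2.2.
  move=> FG AG.
  have swap (T : finType) (q : X * (X1 * T) -> R) :
      \sum_t q t = \sum_u \sum_(xv : X * X1) q (xv.1, (xv.2, u)).
    rewrite sum_pair; under eq_bigr do rewrite sum_pair exchange_big /=.
    by rewrite exchange_big; apply: eq_bigr => u _; rewrite sum_pair.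
  rewrite swap [RHS]swap /= -[RHS](eq_bigr _ (fun u _ => AG u)) -(wAi (inr jj)).
  rewrite -slots => [|u ->]; last by rewrite mul0r.
  apply: eq_bigr => j _; under eq_bigr do rewrite P'sl /=.
  case oj : (o j) => [u|] /=; last by rewrite big1 // => xv _; rewrite mul0r.
  rewrite -[RHS]/(w u * A u (inr jj)) AG mulr_sumr; apply: eq_bigr => xv _.
  by rewrite (FG _ _ _ _ oj) mulrA.
have func (S : (X * X1 -> R) -> R) (jj : 'I_4) :
    (forall q q', q =1 q' -> S q = S q') -> S (fun=> 0) = 0 ->
    (forall q c, 0 <= c -> (forall t, 0 <= q t) -> S (fun t => c * q t) = c * S q) ->
    (forall u, A u (inr jj) = S (sl u)) ->
    \sum_j S (fun xv => P' (xv.1, (xv.2, j))) = \sum_u S (sl u).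
  move=> Sext S0 Sscale AS.
  rewrite -[RHS](eq_bigr _ (fun u _ => AS u)) -(wAi (inr jj)).
  rewrite -slots => [|u ->]; last by rewrite mul0r.
  apply: eq_bigr => j _; rewrite (Sext _ _ (P'sl j)).
  case: (o j) => [u|] //=; rewrite -[RHS]/(w u * A u (inr jj)) AS Sscale // => t.
  exact: P0.
have Ent0 (T : finType) : Ent (fun _ : T => 0 : R) = 0.
  by rewrite /Ent big1 ?oppr0 // => t _; rewrite mul0r.
have sum00 (q : X1 -> R) : q =1 (fun=> \sum_(x : X) 0) -> Ent q = 0.
  by move=> q0; rewrite -(Ent0 X1); apply: eq_Ent => v; rewrite q0 big1.
exists P', f'; split => //; split => //; split; [|split; [|split]].
- exact: (dist (fun x v _ => d1 x v) (fun x v _ => d1 x v) (@Ordinal 4 2 isT)).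
- apply: (dist (fun x v j => d2 x (f' j v)) (fun x v u => d2 x (f u v)) (@Ordinal 4 3 isT)) => //.
  by move=> j u x v oj; rewrite /f' oj.
- rewrite !mutinfo_slices // m1; congr (_ + _).
  apply: (func (@slice_info X X1) (@Ordinal 4 0 isT)) => //; last 1 first.
  + by move=> q c; exact: slice_info_scale.
  + move=> q q' qq; rewrite /slice_info (eq_Ent qq); congr (_ - _); apply: eq_Ent => v.
    by apply: eq_bigr => x _; rewrite qq.
  + by rewrite /slice_info Ent0 sum00 // subrr.
- rewrite !condent_slices //.
  apply: (func (@slice_ent X X1) (@Ordinal 4 1 isT)) => //; last 1 first.
  + by move=> q c; exact: slice_ent_scale.
  + move=> q q' qq; rewrite /slice_ent; congr (_ - _); apply: eq_Ent => v.
      by apply: eq_bigr => x _; rewrite qq.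
    by apply: eq_bigr => v' _; apply: eq_bigr => x _; rewrite qq.
  + rewrite /slice_ent sum00 // sub0r (eq_Ent (q := fun=> 0)) ?Ent0 ?oppr0 //.
    by move=> _; rewrite big1 // => v _; rewrite big1.
Qed.

End Compression.

(** * Continuity of entropy and removal of the slack *)

Section Compactness.
Variable R : realType.

(** Put s = sqrt x and use - ln s <= 1/s; this gives the continuity of x ln x at 0. *)
Lemma xlnx_le (x : R) : 0 < x -> x <= 1 -> `|x * ln x| <= 2 * Num.sqrt x.
Proof.
move=> x0 x1; pose s := Num.sqrt x.
have s0 : 0 < s by rewrite sqrtr_gt0.
have xs : x = s * s by rewrite -expr2 sqr_sqrtr // ltW.
have ls : - ln s <= s^-1.
  by rewrite -lnV ?posrE //; apply: ltW; apply: ln_sublinear; rewrite invr_gt0.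
have lx : ln x <= 0 by apply: ln_le0.
rewrite normrM (ger0_norm (ltW x0)) (ler0_norm lx) -/s.
rewrite {2}xs lnM ?posrE // xs.
have : s * s * (- ln s) <= s * s * s^-1 by rewrite ler_wpM2l // mulr_ge0 // ltW.
by rewrite mulfK ?gt_eqF //; lra.
Qed.

(** The logarithm is 0 on nonpositive numbers, so the function vanishes left of 0. Continuity on the
    whole line makes entropies continuous on the whole coordinate space. *)
Lemma continuous_xlog2x : continuous (fun x : R => x * log2 x).
Proof.
have cl : continuous (fun x : R => x * ln x).
  move=> x; have [x0|x0|x0] := ltgtP x 0.
  - apply/(@cvgrPdist_lt _ R^o) => e e0.
    near=> y.
    have y0 : y < 0 by near: y; apply: lt_nbhsl.
    by rewrite !ln0 ?ltW // !mulr0 subrr normr0.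
  - apply: continuousM; first exact: cvg_id.
    exact: continuous_ln.
  - rewrite x0 /continuous_at mul0r; apply/(@cvgrPdist_lt _ R^o) => e e0.
    near=> y; rewrite sub0r normrN.
    have [y0|y0] := leP y 0; first by rewrite ln0 // mulr0 normr0.
    have ysmall : `|0 - y| < Num.min 1 ((e / 2) ^+ 2).
      near: y; apply: (@nbhsx_ballx _ R^o); rewrite lt_min ltr01 exprn_gt0 // divr_gt0 //.
    move: ysmall; rewrite sub0r normrN gtr0_norm // lt_min => /andP[y1 ye].
    apply: le_lt_trans (xlnx_le y0 (ltW y1)) _.
    have : Num.sqrt y < e / 2.
      by rewrite -[e / 2]ger0_norm -?sqrtr_sqr ?ltr_sqrt ?exprn_gt0 ?divr_gt0 ?divr_ge0 ?(ltW e0).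
    by lra.
have -> : (fun x : R => x * log2 x) = (fun x : R => x * ln x) \* (fun=> (ln 2)^-1).
  by apply/funext => y; rewrite /log2 /= mulrA.
by move=> x; apply: continuousM; [exact: cl|exact: cst_continuous].
Unshelve. all: by end_near.
Qed.

Lemma continuous_sum (T : topologicalType) (I : finType) (F : I -> T -> R) :
  (forall i, continuous (F i)) -> continuous (fun x => \sum_i F i x).
Proof. by move=> Fc; apply: continuous_big => // -[x y]; exact: add_continuous. Qed.

Lemma continuous_Ent (T : topologicalType) (I : finType) (F : I -> T -> R) :
  (forall i, continuous (F i)) -> continuous (fun x => Ent (fun i => F i x)).
Proof.
move=> Fc x; apply: continuousN; apply: continuous_sum => i {}x.
apply: (@continuous_comp _ _ _ (F i) (fun y : R => y * log2 y)); first exact: Fc.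
exact: continuous_xlog2x.
Qed.

(** Twice the positive part, in a form whose continuity is that of the norm. *)
Definition excess (x : R) : R := x + `|x|.

Lemma excess_ge0 x : 0 <= excess x.
Proof. by have := ler_norm (- x); rewrite normrN /excess; lra. Qed.

Lemma excess_le0 x : excess x <= 0 -> x <= 0.
Proof. by have := normr_ge0 x; rewrite /excess; lra. Qed.

Lemma excess_le x e : 0 <= e -> x <= e -> excess x <= 2 * e.
Proof. by move=> e0 xe; rewrite /excess; case: (ger0P x) => _; lra. Qed.

Lemma continuous_excess (T : topologicalType) (F : T -> R) :
  continuous F -> continuous (fun x => excess (F x)).
Proof.
have -> : (fun x => excess (F x)) = F \+ (fun x => `|F x|) by [].
move=> Fc x; apply: continuousD; first exact: Fc.
by apply: continuous_comp; [exact: Fc|exact: norm_continuous].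
Qed.

(* The penalty [g f] measures the violation of the constraints. It attains its minimum on a
   compact box, takes arbitrarily small values for some [f], and there are finitely many [f]. *)
Lemma region_limit (X X1 X2 K : finType) (PX : {ffun X -> R})
    (d1 : X -> X1 -> R) (d2 : X -> X2 -> R) (D1 D2 a b : R) :
  is_pmf PX ->
  (forall eps, 0 < eps -> exists (P : {ffun X * (X1 * K) -> R}) (f : K -> X1 -> X2),
    (forall t, 0 <= P t) /\ marg1 P = PX /\
    \sum_t P t * d1 t.1 t.2.1 <= D1 + eps /\
    \sum_t P t * d2 t.1 (f t.2.2 t.2.1) <= D2 + eps /\
    mutinfo P <= a /\ mutinfo P - condent (marg2 P) <= b) ->
  exists (P : {ffun X * (X1 * K) -> R}) (f : K -> X1 -> X2),
    (forall t, 0 <= P t) /\ marg1 P = PX /\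
    \sum_t P t * d1 t.1 t.2.1 <= D1 /\
    \sum_t P t * d2 t.1 (f t.2.2 t.2.1) <= D2 /\
    mutinfo P <= a /\ mutinfo P - condent (marg2 P) <= b.
Proof.
move=> [PX0 PX1] relaxed.
pose T : finType := (X * (X1 * K))%type.
pose V := 'rV[R]_#|T|.
pose pt (z : V) : {ffun T -> R} := [ffun t => z ord0 (enum_rank t)].
pose tp (P : {ffun T -> R}) : V := \row_j P (enum_val j).
have tpK P : pt (tp P) = P by apply/ffunP => t; rewrite ffunE mxE enum_rankK.
(* Entropy forms of I(X;V,U) and H(V|U), continuous everywhere; they agree with the originals for
   nonnegative [P] with X-marginal [PX]. *)
pose mi (P : {ffun T -> R}) := Ent PX + Ent (marg2 P) - Ent P.
pose ce (P : {ffun T -> R}) := Ent (marg2 P) - Ent (marg2 (marg2 P)).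
pose g (f : {ffun K * X1 -> X2}) z :=
  \sum_x `|marg1 (pt z) x - PX x| +
  excess (\sum_t pt z t * d1 t.1 t.2.1 - D1) +
  excess (\sum_t pt z t * d2 t.1 (f (t.2.2, t.2.1)) - D2) +
  excess (mi (pt z) - a) + excess (mi (pt z) - ce (pt z) - b).
have cpt t : continuous (fun z : V => pt z t).
  rewrite (_ : (fun z => _) = fun z : V => z ord0 (enum_rank t)).
    exact: coord_continuous.
  by apply/funext => z; rewrite ffunE.
have cm1 x : continuous (fun z : V => marg1 (pt z) x).
  rewrite (_ : (fun z => _) = fun z : V => \sum_y pt z (x, y)).
    by apply: continuous_sum => y; exact: cpt.
  by apply/funext => z; rewrite ffunE.
have cm2 y : continuous (fun z : V => marg2 (pt z) y).
  rewrite (_ : (fun z => _) = fun z : V => \sum_x pt z (x, y)).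
    by apply: continuous_sum => x; exact: cpt.
  by apply/funext => z; rewrite ffunE.
have cm3 k : continuous (fun z : V => marg2 (marg2 (pt z)) k).
  rewrite (_ : (fun z => _) = fun z : V => \sum_v marg2 (pt z) (v, k)).
    by apply: continuous_sum => v; exact: cm2.
  by apply/funext => z; rewrite [LHS]ffunE.
have cD (F G : V -> R) : continuous F -> continuous G -> continuous (fun z => F z + G z).
  by move=> cF cG z; apply: continuousD; [exact: cF|exact: cG].
have cB (F G : V -> R) : continuous F -> continuous G -> continuous (fun z => F z - G z).
  by move=> cF cG z; apply: continuousB; [exact: cF|exact: cG].
have cC (c : R) : continuous (fun _ : V => c) by exact: cst_continuous.
have cE (F : T -> R) : continuous (fun z : V => \sum_t pt z t * F t).
  by apply: continuous_sum => t z; apply: continuousM; [exact: cpt|exact: cst_continuous].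
have cE1 : continuous (fun z : V => Ent (pt z)) by exact: continuous_Ent.
have cE2 : continuous (fun z : V => Ent (marg2 (pt z))) by exact: continuous_Ent.
have cE3 : continuous (fun z : V => Ent (marg2 (marg2 (pt z)))) by exact: continuous_Ent.
have cmi : continuous (fun z : V => mi (pt z)) by apply: cB cE1; apply: cD cE2; exact: cC.
have cce : continuous (fun z : V => ce (pt z)) by exact: cB.
have cg f : continuous (g f).
  apply: (cD); last by apply: continuous_excess; apply: (cB _ _ _ (cC b)); exact: cB.
  apply: (cD); last by apply: continuous_excess; exact: cB.
  apply: (cD); last by apply: continuous_excess; exact: cB.
  apply: (cD); last by apply: continuous_excess; exact: cB.
  apply: continuous_sum => x z; apply: (@continuous_comp _ _ _ (fun z : V => marg1 (pt z) x - PX x)).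
    exact: (cB _ _ (cm1 x) (cC _)).
  exact: norm_continuous.
pose box : set V := [set z | forall j, `[0, 1]%classic (z ord0 j)]%classic.
have boxc : compact box.
  by apply: (@rV_compact R #|T| (fun=> `[0, 1]%classic)) => j; exact: segment_compact.
have box0 : (box !=set0)%classic.
  exists 0 => j; rewrite /= mxE. by rewrite in_itv /= lexx ler01.
have /boolp.choice[c cmin] : forall f, exists z, box z /\ forall z', box z' -> g f z <= g f z'.
  move=> f; have [z zbox zmin] := compact_EVT_min box0 boxc (continuous_subspaceT (cg f)).
  exists z; split; first by rewrite inE in zbox.
  by move=> z' z'box; apply: zmin; rewrite inE.
have g0 f z : 0 <= g f z.
  by do 4!(apply: addr_ge0; last exact: excess_ge0); exact: sumr_ge0.
have [[f gf0]|allpos] := EM (exists f, g f (c f) <= 0).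
  have [cbox _] := cmin f.
  exists (pt (c f)), (fun k v => f (k, v)).
  have P0 t : 0 <= pt (c f) t by rewrite ffunE; have := cbox (enum_rank t); rewrite /= in_itv => /andP[].
  move: gf0; rewrite /g.
  set s1 := \sum_x _; set s2 := excess _; set s3 := excess _; set s4 := excess _; set s5 := excess _.
  move=> gf0.
  have h1 : 0 <= s1 by exact: sumr_ge0.
  have h2 : 0 <= s2 by exact: excess_ge0.
  have h3 : 0 <= s3 by exact: excess_ge0.
  have h4 : 0 <= s4 by exact: excess_ge0.
  have h5 : 0 <= s5 by exact: excess_ge0.
  have m1 : marg1 (pt (c f)) = PX.
    apply/ffunP => x; apply/eqP; rewrite -subr_eq0 -normr_le0.
    apply: (@le_trans _ _ s1); last by lra.
    exact: (@le_sum1 _ _ (fun x => `|marg1 (pt (c f)) x - PX x|)).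
  have e2 : s2 <= 0 by lra.
  have e3 : s3 <= 0 by lra.
  have e4 : s4 <= 0 by lra.
  have e5 : s5 <= 0 by lra.
  have miE : mutinfo (pt (c f)) = mi (pt (c f)) by rewrite mutinfoE // m1.
  have ceE : condent (marg2 (pt (c f))) = ce (pt (c f)).
    by rewrite condentE //; exact: marg2_ge0.
  rewrite miE ceE; split=> //; split => //.
  by split; [|split; [|split]]; rewrite -subr_le0; apply: excess_le0.
exfalso.
have gpos f : 0 < g f (c f).
  by rewrite ltNge; apply/negP => gf; apply: allpos; exists f.
(* [S] dominates the inverse of each of the finitely many positive minima, so 4 [eps] = 1/(1 + S)
   lies below all of them. The relaxed law has penalty at most 4 [eps], 2 [eps] for each distortion,
   which is a contradiction. *)
pose S := \sum_f (g f (c f))^-1.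
have S0 : 0 <= S by apply: sumr_ge0 => f _; rewrite invr_ge0.
pose eps := (4 * (1 + S))^-1.
have S1 : 0 < 4 * (1 + S) by lra.
have eps0 : 0 < eps by rewrite invr_gt0.
have [P [f [P0 [m1 [h1 [h2 [h3 h4]]]]]]] := relaxed eps eps0.
pose f' : {ffun K * X1 -> X2} := [ffun kv => f kv.1 kv.2].
have Pbox : box (tp P).
  move=> j; rewrite /= mxE in_itv /= P0 /=.
  have P1 : \sum_t P t = 1.
    rewrite sum_pair -PX1; apply: eq_bigr => x _.
    by rewrite -m1 ffunE.
  by rewrite -P1; exact: le_sum1.
have [_ /(_ _ Pbox) gle] := cmin f'.
have miE : mutinfo P = mi P by rewrite mutinfoE // m1.
have ceE : condent (marg2 P) = ce P by rewrite condentE //; exact: marg2_ge0.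
have gP : g f' (tp P) <= 4 * eps.
  rewrite /g tpK m1 -miE -ceE.
  have -> : \sum_x `|PX x - PX x| = 0 by rewrite big1 // => x _; rewrite subrr normr0.
  have -> : \sum_t P t * d2 t.1 (f' (t.2.2, t.2.1)) = \sum_t P t * d2 t.1 (f t.2.2 t.2.1).
    by apply: eq_bigr => t _; rewrite ffunE.
  have e1 := @excess_le (\sum_t P t * d1 t.1 t.2.1 - D1) eps (ltW eps0).
  have e2 := @excess_le (\sum_t P t * d2 t.1 (f t.2.2 t.2.1) - D2) eps (ltW eps0).
  have e3 := @excess_le (mutinfo P - a) 0 (lexx 0).
  have e4 := @excess_le (mutinfo P - condent (marg2 P) - b) 0 (lexx 0).
  have {}e1 : excess (\sum_t P t * d1 t.1 t.2.1 - D1) <= 2 * eps by apply: e1; lra.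
  have {}e2 : excess (\sum_t P t * d2 t.1 (f t.2.2 t.2.1) - D2) <= 2 * eps by apply: e2; lra.
  have {}e3 : excess (mutinfo P - a) <= 2 * 0 by apply: e3; lra.
  have {}e4 : excess (mutinfo P - condent (marg2 P) - b) <= 2 * 0 by apply: e4; lra.
  by lra.
have : (g f' (c f'))^-1 <= S.
  by apply: (@le_sum1 _ _ (fun f => (g f (c f))^-1)) => h; rewrite invr_ge0.
have epsE : 4 * eps = (1 + S)^-1 by rewrite /eps invfM mulrA mulfV ?mul1r ?pnatr_eq0.
have : g f' (c f') <= (1 + S)^-1 by rewrite -epsE (le_trans gle).
rewrite -[X in X <= _ -> _](invrK (g f' (c f'))) lef_pV2 ?posrE ?invr_gt0 //; lra.
Qed.

End Compactness.

Lemma achievable_region (R : realType) (X X1 X2 : finType) (PX : {ffun X -> R})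
    (d1 : X -> X1 -> R) (d2 : X -> X2 -> R) (D1 D2 : R) (r : R * R) :
  is_pmf PX -> achievable PX d1 d2 D1 D2 r -> sr_region PX d1 d2 D1 D2 r.
Proof.
move=> PXpmf ach.
(* The encoders have at least one message available, so both rates are nonnegative; this gives the
   sign condition on R1 and the positive part in the bound on R0. *)
have [r10 r20] : 0 <= r.1 /\ 0 <= r.2.
  have [n [n0 [M0 [M1 [hM0 [hM1 [f0 [f1 _]]]]]]]] := ach 1 ltr01.
  have nr : 0 < n%:R :> R by rewrite ltr0n.
  have [x0 _] : exists x0 : n.-tuple X, true.
    case: (pickP (fun _ : n.-tuple X => true)) => [x0 _|N]; first by exists x0.
    by have := sum_iid PXpmf n; rewrite big_pred0 // => /esym/eqP; rewrite oner_eq0.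
  have rate_ge0 (M : nat) (s : R) : 'I_M -> M%:R <= 2 `^ (n%:R * s) -> 0 <= s.
    move=> m Ms; have M0' : (0 < M)%N by exact: leq_ltn_trans (leq0n _) (ltn_ord m).
    rewrite -(pmulr_rge0 _ nr); apply: le_trans (le_log2_card M0' Ms).
    by rewrite -(log2_1 R); apply: log2_le => //; rewrite ler1n.
  by split; [exact: rate_ge0 (f0 x0) hM0|exact: rate_ge0 (f1 x0) hM1].
split=> //; pose k := (#|X| * #|X1| + 4)%N.
have [] := @region_limit R X X1 X2 'I_k PX d1 d2 D1 D2 (r.1 + r.2) r.1 PXpmf.
  move=> eps /ach[n [n0 [M0 [M1 [hM0 [hM1 [f0 [f1 [g1 [g2 [h1 h2]]]]]]]]]]].
  have [U [P [f [Ppmf [m1 [e1 [e2 [e3 e4]]]]]]]] :=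
    code_converse PXpmf n0 hM0 hM1 h1 h2.
  have [P' [f' [P'0 [m1' [e1' [e2' [e3' e4']]]]]]] := compress_auxiliary f d1 d2 Ppmf.
  by exists P', f'; rewrite m1' e1' e2' e3' e4'.
move=> P [f [P0 [m1 [e1 [e2 [e3 e4]]]]]].
exists 'I_k, P, f; split; first by rewrite card_ord.
split; last by rewrite ge_max e4 r10.
split=> //; have [_ <-] := PXpmf; rewrite sum_pair; apply: eq_bigr => x _.
by rewrite -m1 ffunE.
Qed.

Unset Implicit Arguments.
Local Open Scope classical_set_scope.

Theorem theorem5 (R : realType) (X X1 X2 : finType) (PX : {ffun X -> R})
  (d1 : X -> X1 -> R) (d2 : X -> X2 -> R) (D1 D2 : R) :
  is_pmf PX ->
  (forall x a, 0 <= d1 x a) -> (forall x b, 0 <= d2 x b) ->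
  closure [set r : R * R | achievable PX d1 d2 D1 D2 r] =
  closure [set r : R * R | sr_region PX d1 d2 D1 D2 r].
Proof.
move=> PXpmf d10 d20; apply/seteqP; split.
  by apply: closure_subset => r; exact: achievable_region.
have /closure_id clE := @closed_closure _ [set r : R * R | achievable PX d1 d2 D1 D2 r].
rewrite [X in _ `<=` X]clE.
apply: closure_subset => r hr B /nbhs_ballP[e /= e0 eB].
(* The rate slack of the direct part is absorbed by the closure: this shifted point is achievable
   and stays in the ball of radius [e]. *)
exists (r.1 + e / 2, r.2 + e / 2); split.
  by apply: (region_achievable d10 d20 hr); rewrite divr_gt0.
apply: eB; split; rewrite /ball /= opprD addrA subrr sub0r normrN gtr0_norm ?divr_gt0 //; lra.
Qed.
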